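(* Let $D$ be a positive integer and $\Gamma\subseteq\mathbb{R}^D$ orthosymmetric, compact and convex. If a pair of positive integers $(m,n)$ lies in the LFHT feasible region of $\Gamma$ at scale $\epsilon$, then $$m\ge\frac1{\epsilon^2},\qquad n\ge\frac{\sqrt{n_{\mathrm{est}}(\Gamma,\sqrt2\epsilon)}}{8\epsilon\sqrt{\log(4D)}},\qquad mn\ge\frac{n_{\mathrm{est}}(\Gamma,\sqrt2\epsilon)-1}{3072\,\epsilon^2\log(4D)}.$$
   Context: Orthosymmetric: closed under flipping signs of any coordinates. $n_{\mathrm{est}}(\Gamma,\epsilon)$: smallest $n$ such that from $n$ i.i.d. samples of $\mathcal N(\boldsymbol\theta,I_D)$ some estimator has $\sup_{\boldsymbol\theta\in\Gamma}\mathbb E\|\hat{\boldsymbol\theta}-\boldsymbol\theta\|_2^2\le\epsilon^2$. Likelihood-free hypothesis testing (LFHT): unknown $\boldsymbol\theta^1,\boldsymbol\theta^2,\boldsymbol\theta\in\Gamma$ with $\|\boldsymbol\theta^1-\boldsymbol\theta^2\|_2\ge\epsilon$; one observes $\mathbf X$ ($n$ i.i.d. samples of $\mathcal N(\boldsymbol\theta^1,I_D)$), $\mathbf Y$ ($n$ i.i.d. samples of $\mathcal N(\boldsymbol\theta^2,I_D)$) and $\mathbf Z$ ($m$ i.i.d. samples of $\mathcal N(\boldsymbol\theta,I_D)$), all independent, and tests $H_0:\boldsymbol\theta=\boldsymbol\theta^1$ vs $H_1:\boldsymbol\theta=\boldsymbol\theta^2$ by $\psi(\mathbf X,\mathbf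 Y,\mathbf Z)\in\{0,1\}$. $(m,n)$ lies in the feasible region at scale $\epsilon$ if some $\psi$ satisfies $\max_{i\in\{0,1\}}\sup_{H_i}\mathbb P(\psi\ne i)\le1/4$, where the supremum over $H_i$ ranges over all $\boldsymbol\theta^1,\boldsymbol\theta^2\in\Gamma$ with $\|\boldsymbol\theta^1-\boldsymbol\theta^2\|_2\ge\epsilon$ and $\boldsymbol\theta=\boldsymbol\theta^{i+1}$.
   Formalization: It is additionally assumed that ε > 0 and that Γ contains two points at ℓ2-distance at least ε; otherwise the testing problem is vacuous and m ≥ 1/ε² can fail (e.g. Γ = {0}, ε = 1/2, m = n = 1). *)

(* Defs.v *)
From HB Require Import structures.
From mathcomp Require Import all_boot all_algebra.
From mathcomp Require Import all_classical all_reals all_analysis.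
Set Implicit Arguments.
Unset Strict Implicit.
Unset Printing Implicit Defensive.
Import GRing.Theory Num.Theory.
Import numFieldNormedType.Exports.
Local Open Scope classical_set_scope.
Local Open Scope ring_scope.

Definition l2norm (R : realType) (D : nat) (v : 'rV[R]_D) : R :=
  Num.sqrt (\sum_(i < D) v ord0 i ^+ 2).

Definition orthosymmetric (R : realType) (D : nat) (G : set 'rV[R]_D) : Prop :=
  forall x, G x -> forall s : 'I_D -> bool,
    G (\row_(i < D) (if s i then - x ord0 i else x ord0 i)).

Definition convex_set_rV (R : realType) (D : nat) (G : set 'rV[R]_D) : Prop :=
  forall x y, G x -> G y -> forall t : R, 0 <= t -> t <= 1 ->
    G (t *: x + (1 - t) *: y).

(* A family xi j i (j : nat = sample index, i : 'I_D = coordinate) of mutually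
   independent standard normal real random variables on (Omega, P).
   Mutual independence: product rule for all rows j < N (taking A = setT in
   some coordinates gives every finite subfamily). *)
Definition std_normal_family (R : realType) (d : measure_display)
    (Omega : measurableType d) (P : probability Omega R) (D : nat)
    (xi : nat -> 'I_D -> Omega -> R) : Prop :=
  (forall j i, measurable_fun setT (xi j i)) /\
  (forall j i (A : set R), measurable A ->
      P (xi j i @^-1` A) = normal_prob 0 1 A) /\
  (forall (N : nat) (A : nat -> 'I_D -> set R),
      (forall j i, measurable (A j i)) ->
      P [set w | forall j, (j < N)%N -> forall i, A j i (xi j i w)] =
      (\prod_(j < N) \prod_(i < D) P (xi j i @^-1` A j i))%E).

(* The j-th observation theta + noise row j, as a D-tuple (measurable space). *)
Definition obs (R : realType) (d : measure_display) (Omega : measurableType d)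
    (D : nat) (xi : nat -> 'I_D -> Omega -> R) (theta : 'rV[R]_D) (j : nat)
    (w : Omega) : D.-tuple R :=
  [tuple theta ord0 i + xi j i w | i < D].

(* n i.i.d. samples of N(theta, I_D), using noise rows k, k+1, ..., k+n-1. *)
Definition sample (R : realType) (d : measure_display) (Omega : measurableType d)
    (D : nat) (xi : nat -> 'I_D -> Omega -> R) (theta : 'rV[R]_D) (k n : nat)
    (w : Omega) : n.-tuple (D.-tuple R) :=
  [tuple obs xi theta (k + j) w | j < n].

Definition sqerr (R : realType) (D : nat) (t : D.-tuple R) (theta : 'rV[R]_D) : R :=
  \sum_(i < D) (tnth t i - theta ord0 i) ^+ 2.

Definition estimable (R : realType) (d : measure_display) (Omega : measurableType d)
    (P : probability Omega R) (D : nat) (xi : nat -> 'I_D -> Omega -> R)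
    (G : set 'rV[R]_D) (eps : R) (n : nat) : Prop :=
  exists est : n.-tuple (D.-tuple R) -> D.-tuple R,
    measurable_fun setT est /\
    forall theta, G theta ->
      (\int[P]_w (sqerr (est (sample xi theta 0 n w)) theta)%:E <= (eps ^+ 2)%:E)%E.

Definition is_n_est (R : realType) (d : measure_display) (Omega : measurableType d)
    (P : probability Omega R) (D : nat) (xi : nat -> 'I_D -> Omega -> R)
    (G : set 'rV[R]_D) (eps : R) (N : nat) : Prop :=
  estimable P xi G eps N /\ forall k, estimable P xi G eps k -> (N <= k)%N.

(* (m, n) lies in the LFHT feasible region of G at scale eps.
   X uses noise rows 0..n-1, Y rows n..2n-1, Z rows 2n..2n+m-1 (independent). *)
Definition lfht_feasible (R : realType) (d : measure_display) (Omega : measurableType d)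
    (P : probability Omega R) (D : nat) (xi : nat -> 'I_D -> Omega -> R)
    (G : set 'rV[R]_D) (eps : R) (m n : nat) : Prop :=
  exists psi : n.-tuple (D.-tuple R) * n.-tuple (D.-tuple R) * m.-tuple (D.-tuple R) -> bool,
    measurable_fun setT psi /\
    forall theta1 theta2, G theta1 -> G theta2 -> eps <= l2norm (theta1 - theta2) ->
      (P [set w | psi (sample xi theta1 0 n w, sample xi theta2 n n w,
                       sample xi theta1 (n + n) m w) != false] <= (1 / 4 : R)%:E)%E /\
      (P [set w | psi (sample xi theta1 0 n w, sample xi theta2 n n w,
                       sample xi theta2 (n + n) m w) != true] <= (1 / 4 : R)%:E)%E.

(* Main.v *)
Require Import Defs.
From HB Require Import structures.
From mathcomp Require Import all_boot all_order all_algebra.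
From mathcomp Require Import all_classical all_reals all_analysis.
From mathcomp Require Import measurable_realfun.
From mathcomp Require Import ring lra.
Set Implicit Arguments.
Unset Strict Implicit.
Unset Printing Implicit Defensive.
Import Order.TTheory GRing.Theory Num.Theory.
Import numFieldNormedType.Exports.
Local Open Scope classical_set_scope.
Local Open Scope ring_scope.

(** Upper bound on [n_est]: soft thresholding at level [sqrt (2 L / k)], with
    [L = ln (4 D)], has risk at most
    [3/2 * \sum_i min (theta_i^2) (8 L / k) + 3 / (2 k)].  So if [k] samples do
    not suffice at scale [sqrt 2 * eps] and [k * eps^2 >= 3], then some theta in
    [G] has [\sum_i min (theta_i^2) (8 L / k) >= eps^2]; as [G] is solid, it
    contains a box with half-widths [a_i], [a_i^2 <= 8 L / k], of any prescribed
    norm at most [eps].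

    Lower bounds on (m, n): average the likelihoods of both hypotheses over
    random signs.  Putting [theta1 = s a], [theta2 = - s a], both averages are
    products of factors [q (1 + t)] and [q (1 - t)], where [q] is the law for which
    the signs of (X, Y) and of Z are independent, [t = tanh u * tanh z], and
    [E_q t^2 <= (1 - exp (- 2 n A)) (1 - exp (- m A))]; a chi-square bound
    relative to [q] gives [m n \sum_i a_i^4 >= const], and, with a single common
    sign, [m eps^2 >= 1].  Putting [theta1 = 0], [theta2 = s a] and Z centred
    gives [n^2 \sum_i a_i^4 >= const].  Every expectation involved is that of an
    exponential of a linear form, given by the Cameron-Martin formula. *)

(** * Gaussian shifts *)

Section gaussian_shift.
Context {R : realType}.
Local Open Scope ereal_scope.
Local Notation mu := (@lebesgue_measure R).

Lemma lebesgue_measure_shift (c : R) (A : set R) : measurable A ->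
  pushforward mu (+%R c : _ -> measurableTypeR R) A = mu A.
Proof.
move=> mA.
have mc : measurable_fun setT (+%R c : measurableTypeR R -> measurableTypeR R).
  by apply: measurable_funD.
apply/esym.
apply: (@lebesgue_measure_unique _ (pushforward mu (+%R c : measurableTypeR R -> measurableTypeR R))) => //=.
move=> _ [[a b]] _ <-.
rewrite /pushforward.
rewrite (_ : _ @^-1` _ = `](a - c)%R, (b - c)%R]%classic); last first.
  by apply/seteqP; split=> x /=; rewrite !in_itv/= ltrBlDl lerBrDl.
by rewrite !lebesgue_measure_itv/= !lte_fin ltrD2r -!EFinD opprB addrA subrK.
Qed.

Lemma ge0_integral_shift (c : R) (f : R -> \bar R) :
  measurable_fun setT f -> (forall x, 0 <= f x) ->
  \int[mu]_x f (c + x)%R = \int[mu]_x f x.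
Proof.
move=> mf f0.
have mc : measurable_fun setT (+%R c : measurableTypeR R -> measurableTypeR R).
  by apply: measurable_funD.
rewrite -[LHS](ge0_integral_pushforward mc _ measurableT)//.
by apply: eq_measure_integral => A mA _; exact: lebesgue_measure_shift.
Qed.

(** The Radon-Nikodym derivative of the normal law and [normal_pdf] have the same integral over
    every measurable set, hence agree almost everywhere, so one may replace the other under the
    integral. *)
Lemma ge0_integral_normal_prob (f : R -> \bar R) :
  measurable_fun setT f -> (forall x, 0 <= f x) ->
  \int[normal_prob 0 1]_x f x = \int[mu]_x (f x * (normal_pdf 0 1 x)%:E).
Proof.
move=> mf f0.
have dom := @normal_prob_dominates R 0 1.
rewrite -(Radon_Nikodym_SigmaFinite.change_of_variables dom)//.
have if_ := Radon_Nikodym_SigmaFinite.f_integrable dom.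
apply: ae_eq_integral => //.
- by apply: emeasurable_funM => //; exact: measurable_int if_.
- apply: emeasurable_funM => //; apply/measurable_EFinP.
  exact: measurable_normal_pdf.
- apply: ae_eqe_mul2l.
  apply: integral_ae_eq => //.
  + by apply/measurable_EFinP; exact: measurable_normal_pdf.
  + move=> E _ mE.
    by rewrite -Radon_Nikodym_SigmaFinite.f_integral.
Qed.

(** Cameron-Martin in dimension one: Lebesgue measure is translation invariant, and completing the
    square shows that translation by [c] costs the factor [expR (c * x - c ^+ 2 / 2)]. *)
Lemma normal_prob_shift (c : R) (f : R -> \bar R) :
  measurable_fun setT f -> (forall x, 0 <= f x) ->
  \int[normal_prob 0 1]_x f (c + x)%R =
  \int[normal_prob 0 1]_x (f x * (expR (c * x - c ^+ 2 / 2))%:E).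
Proof.
move=> mf f0.
have mc : measurable_fun setT (+%R c : measurableTypeR R -> measurableTypeR R).
  by apply: measurable_funD.
have me : measurable_fun setT (fun x : R => expR (c * x - c ^+ 2 / 2)).
  apply: measurableT_comp => //; apply: measurable_funB => //.
rewrite ge0_integral_normal_prob; last 2 first.
  by apply: measurableT_comp mf mc.
  by [].
rewrite ge0_integral_normal_prob; last 2 first.
  by apply: emeasurable_funM => //; exact/measurable_EFinP.
  by move=> x; rewrite mule_ge0 // lee_fin expR_ge0.
rewrite -(@ge0_integral_shift c (fun x => f x * _ * _)); last 2 first.
  apply: emeasurable_funM.
    by apply: emeasurable_funM => //; exact/measurable_EFinP.
  by apply/measurable_EFinP; exact: measurable_normal_pdf.
  by move=> x; rewrite !mule_ge0 // lee_fin ?expR_ge0 ?normal_pdf_ge0.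
apply: eq_integral => x _; rewrite -muleA -EFinM; congr (_ * _%:E).
rewrite !normal_pdfE ?oner_eq0// mulrCA; congr (_ * _)%R.
rewrite /normal_fun -expRD; congr expR.
by field.
Qed.

End gaussian_shift.

(** * Measures on tuples are determined by rectangles *)

Section tuple_measure.
Context {R : realType}.
Local Open Scope ereal_scope.

Lemma measurable_rect K (A : 'I_K -> set R) : (forall k, measurable (A k)) ->
  measurable [set t : K.-tuple R | forall k, A k (tnth t k)].
Proof.
move=> mA.
rewrite (_ : mkset _ = \bigcap_(k in [set: 'I_K])
    ((fun t : K.-tuple R => tnth t k) @^-1` A k)); last first.
  by apply/seteqP; split => t /= h k; [move=> _; exact: h|exact: h].
apply: fin_bigcap_measurable => [//|k _].
by rewrite -[X in measurable X]setTI; exact: measurable_tnth.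
Qed.

(** Rectangles are stable under intersection and generate the product sigma-algebra, so the
    uniqueness theorem for measures applies. *)
Lemma rect_measure_unique K (m1 m2 : {measure set (K.-tuple R) -> \bar R}) :
  m1 setT < +oo ->
  (forall A : 'I_K -> set R, (forall k, measurable (A k)) ->
     m1 [set t | forall k, A k (tnth t k)] =
     m2 [set t | forall k, A k (tnth t k)]) ->
  forall B, measurable B -> m1 B = m2 B.
Proof.
move=> m1T m12 B mB.
pose C : set (set (K.-tuple R)) := [set X | exists2 A : 'I_K -> set R,
  (forall k, measurable (A k)) & X = [set t | forall k, A k (tnth t k)]].
have CT : C setT.
  by exists (fun=> setT) => //; apply/seteqP; split.
apply: (measure_unique C (fun=> setT)) => //.
- apply/seteqP; split => [X mX|].
    move: mX; apply: smallest_sub; first exact: smallest_sigma_algebra.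
    rewrite -bigcup_seq => Y [k _ [Z mZ <-]].
    apply: sub_sigma_algebra.
    exists (fun i => if i == k then Z else setT).
      by move=> i; case: ifP.
    rewrite setTI; apply/seteqP; split => t /=.
      by move=> Zt i; case: eqP => [->|].
    by move=> /(_ k); rewrite eqxx.
  apply: smallest_sub; first exact: sigma_algebra_measurable.
  by move=> X [A mA ->]; exact: measurable_rect.
- move=> _ _ [A mA ->] [A' mA' ->]; exists (fun k => A k `&` A' k).
    by move=> k; exact: measurableI.
  apply/seteqP; split => t /=.
    by move=> [At A't] k; split.
  by move=> h; split => k; have [] := h k.
- by rewrite bigcup_const.
- by move=> X [A mA ->]; exact: m12.
Qed.

End tuple_measure.

(** * The Cameron-Martin formula for a finite family of independent standard normals *)

Section cameron_martin.
Context {R : realType} {d : measure_display} {Omega : measurableType d}.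
Variable P : probability Omega R.
Local Open Scope ereal_scope.
Local Notation N01 := (@normal_prob R 0 1).

(** The family is indexed by [nat], with the joint law prescribed on the first [K] entries, so that
    removing the head is composition with [S]; this suits the induction on [K]. *)
Definition indep_normal (K : nat) (z : nat -> Omega -> R) :=
  (forall k, measurable_fun setT (z k)) /\
  forall A : nat -> set R, (forall k, measurable (A k)) ->
    P [set w | forall k, (k < K)%N -> A k (z k w)] = \prod_(k < K) N01 (A k).

Definition flat (K : nat) (z : nat -> Omega -> R) (w : Omega) : K.-tuple R :=
  [tuple z k w | k < K].

Lemma measurable_flat K z : (forall k, measurable_fun setT (z k)) ->
  measurable_fun setT (flat K z).
Proof.
move=> mz; apply/measurable_fun_tnthP => k.
rewrite (_ : _ \o _ = z k)//.
by apply/funext => w /=; rewrite tnth_mktuple.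
Qed.

Lemma flatS K z w : flat K.+1 z w = [tuple of z 0%N w :: flat K (z \o S) w].
Proof.
apply: eq_from_tnth => i; rewrite tnth_mktuple.
case: (unliftP ord0 i) => [j ->|->].
  by rewrite tnthS tnth_mktuple.
by rewrite tnth0.
Qed.

Lemma indep_normal_tail K z : indep_normal K.+1 z -> indep_normal K (z \o S).
Proof.
move=> [mz iz]; split => [k|A mA]; first exact: mz.
pose A' k := if k is k'.+1 then A k' else [set: R].
have mA' k : measurable (A' k) by case: k => [|k] /=.
have := iz A' mA'.
rewrite big_ord_recl/= [N01 _](probability_setT) mul1e => <-.
congr (P _); apply/seteqP; split => w /=.
  by move=> h [|k]//; exact: h.
by move=> h k kK; exact: (h k.+1).
Qed.

(** For fixed [A] both sides are finite measures in [B]: the tail's image of [P] restricted to the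
    event on the head, and a rescaled law of the tail. They agree on rectangles, by joint
    independence. *)
Lemma indep_normal_prod K z : indep_normal K.+1 z ->
  forall A B, measurable A -> measurable B ->
  P [set w | A (z 0%N w) /\ B (flat K (z \o S) w)] =
  N01 A * P [set w | B (flat K (z \o S) w)].
Proof.
move=> iz A B mA mB; have [mz izA] := iz; have [mt itA] := indep_normal_tail iz.
have mfl := measurable_flat (K := K) mt.
have mA' : measurable (z 0%N @^-1` A).
  by rewrite -[X in measurable X]setTI; exact: mz.
have a0 : (0 <= fine (N01 A))%R by rewrite fine_ge0.
have aE : (fine (N01 A))%:E = N01 A by rewrite fineK// fin_num_measure.
pose fl := flat K (z \o S).
pose X : {RV P >-> (K.-tuple R : measurableType _)} := mfun_Sub (mem_set mfl).
suff key : pushforward (mrestr P mA') fl B =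
    mscale (NngNum a0) (distribution P X) B.
  transitivity (pushforward (mrestr P mA') fl B).
    by congr (P _); apply/seteqP; split => w /= [].
  by rewrite key /mscale /= aE.
apply: (@rect_measure_unique R K (pushforward (mrestr P mA') fl)
  (mscale (NngNum a0) (distribution P X))) => //.
  apply: (@le_lt_trans _ _ 1); last exact: ltry.
  by apply: probability_le1; apply: measurableI => //; rewrite preimage_setT.
move=> C mC.
rewrite [RHS](_ : _ = N01 A * P [set w | forall k, C k (tnth (fl w) k)]);
  last by rewrite /mscale; congr (_ * _); exact: aE.
rewrite /fl.
(* [C'] extends the sides of the rectangle from ordinals to all naturals, with default [setT] from
   [K] on. *)
pose C' k := if @insub nat (fun k => k < K)%N _ k is Some i then C i else setT.
have mC' k : measurable (C' k) by rewrite /C'; case: insubP.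
have C'E w : (forall k, (k < K)%N -> C' k (z k.+1 w)) <-> (forall k, C k (tnth (flat K (z \o S) w) k)).
  split=> [h k|h k kK].
    have := h k (ltn_ord k); rewrite /C' tnth_mktuple.
    by case: insubP => [u _ /val_inj ->|/negP[]].
  rewrite /C'; case: insubP => [u _ uk|//]; rewrite -uk.
  by have := h u; rewrite tnth_mktuple.
transitivity (N01 A * \prod_(k < K) N01 (C' k)); last first.
  rewrite -itA//; congr (_ * P _); apply/seteqP; split => w /=.
    by move/C'E.
  by move=> h; apply/C'E.
pose C0 k := if k is k'.+1 then C' k' else A.
have mC0 k : measurable (C0 k) by case: k => [|k] /=.
have := izA C0 mC0; rewrite big_ord_recl/= => <-.
congr (P _); apply/seteqP; split => w /=.
  by move=> [/C'E h Aw] [_|k kK]; [exact: Aw|exact: h].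
move=> h; split; last exact: (h 0%N).
by apply/C'E => k kK; exact: (h k.+1).
Qed.

(** The pair (head, tail) has a product law, so Tonelli applies. Both orders of integration are
    recorded: the induction below shifts the tail with the head frozen, then the head with the tail
    frozen. *)
Lemma ge0_integral_indep_normal K z : indep_normal K.+1 z ->
  forall F : measurableTypeR R * K.-tuple R -> \bar R, measurable_fun setT F ->
  (forall x, 0 <= F x) ->
  \int[P]_w F (z 0%N w, flat K (z \o S) w) =
    \int[N01]_x \int[P]_w F (x, flat K (z \o S) w) /\
  \int[P]_w F (z 0%N w, flat K (z \o S) w) =
    \int[P]_w \int[N01]_x F (x, flat K (z \o S) w).
Proof.
move=> iz F mF F0; have [mz izA] := iz; have [mt itA] := indep_normal_tail iz.
have mfl := measurable_flat (K := K) mt.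
pose X : {RV P >-> (K.-tuple R : measurableType _)} := mfun_Sub (mem_set mfl).
pose phi w : measurableTypeR R * K.-tuple R := (z 0%N w, flat K (z \o S) w).
have mphi : measurable_fun setT phi by apply: measurable_fun_pair => //; exact: mz.
have -> : \int[P]_w F (z 0%N w, flat K (z \o S) w) =
    \int[N01 \x distribution P X]_y F y.
  transitivity (\int[pushforward P phi]_y F y).
    by rewrite ge0_integral_pushforward.
  apply: eq_measure_integral => A mA _; apply/esym.
  apply: product_measure_unique => //.
  move=> B C mB mC; exact: (indep_normal_prod iz mB mC).
split.
  rewrite fubini_tonelli1//; apply: eq_integral => x _.
  rewrite /fubini_F ge0_integral_pushforward//.
  exact: measurableT_comp.
rewrite fubini_tonelli2//.
rewrite ge0_integral_pushforward//.
  exact: measurable_fun_fubini_tonelli_G.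
by move=> y _; apply: integral_ge0.
Qed.

(** Induction on [K]: [F1] has both parts shifted, [F2] has exchanged the tail shift for its density
    by the induction hypothesis, and [F3] has exchanged the head shift too, by
    [normal_prob_shift]. *)
Theorem cameron_martin K z (theta : nat -> R) (F : K.-tuple R -> \bar R) :
  indep_normal K z -> measurable_fun setT F -> (forall x, 0 <= F x) ->
  \int[P]_w F (flat K (fun k w => theta k + z k w)%R w) =
  \int[P]_w (F (flat K z w) *
    (expR (\sum_(k < K) (theta k * z k w - theta k ^+ 2 / 2)))%:E).
Proof.
elim: K z theta F => [|K IH] z theta F iz mF F0.
  apply: eq_integral => w _; rewrite big_ord0 expR0 mule1; congr F.
  by apply: eq_from_tnth => -[].
have [mz _] := iz; have it := indep_normal_tail iz.
have mfl := measurable_flat (K := K) it.1.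
have mcons (c : R) : measurable_fun [set: measurableTypeR R * K.-tuple R]
    (fun y => [tuple of c + y.1 :: y.2])%R.
  by apply: measurable_cons => //; apply: measurable_funD.
have mcons' (c : R) (th : nat -> R) : measurable_fun [set: measurableTypeR R * K.-tuple R]
    (fun y => [tuple of c + y.1 :: [tuple th k + tnth y.2 k | k < K]])%R.
  apply: measurable_cons; first by apply: measurable_funD.
  apply/measurable_fun_tnthP => k.
  rewrite (_ : _ \o _ = fun y => th k + tnth y.2 k)%R; last first.
    by apply/funext => y /=; rewrite tnth_mktuple.
  apply: measurable_funD => //.
  by apply: (measurableT_comp (measurable_tnth k)).
pose L y : R := expR (\sum_(k < K) (theta k.+1 * tnth y k - theta k.+1 ^+ 2 / 2)).
have mL : measurable_fun [set: K.-tuple R] L.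
  apply: measurableT_comp => //; apply: measurable_sum => k.
  apply: measurable_funB => //; apply: measurable_funM => //.
  exact: measurable_tnth.
have me : measurable_fun setT (fun x : R => expR (theta 0%N * x - theta 0%N ^+ 2 / 2)).
  by apply: measurableT_comp => //; apply: measurable_funB.
transitivity (\int[P]_w F [tuple of (theta 0%N + z 0%N w)%R ::
    [tuple (theta k.+1 + tnth (flat K (z \o S) w) k)%R | k < K]]).
  apply: eq_integral => w _; rewrite flatS; congr (F [tuple of _ :: _]).
  by apply: eq_from_tnth => k; rewrite !tnth_mktuple.
pose F1 (y : measurableTypeR R * K.-tuple R) := F [tuple of (theta 0%N + y.1)%R ::
    [tuple (theta k.+1 + tnth y.2 k)%R | k < K]].
have mF1 : measurable_fun setT F1.
  exact: (measurableT_comp mF (mcons' (theta 0%N) (theta \o S))).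
have F10 y : 0 <= F1 y by exact: F0.
have [-> _] := ge0_integral_indep_normal iz mF1 F10.
pose F2 (y : measurableTypeR R * K.-tuple R) :=
  F [tuple of (theta 0%N + y.1)%R :: y.2] * (L y.2)%:E.
have mF2 : measurable_fun setT F2.
  apply: emeasurable_funM; first exact: (measurableT_comp mF (mcons _)).
  by apply/measurable_EFinP; exact: measurableT_comp.
have F20 y : 0 <= F2 y by rewrite mule_ge0// lee_fin expR_ge0.
transitivity (\int[N01]_x \int[P]_w F2 (x, flat K (z \o S) w)).
  apply: eq_integral => x _; rewrite /F1 /F2 /=.
  have mx : measurable_fun [set: K.-tuple R]
      (fun y => F [tuple of (theta 0%N + x)%R :: y]).
    by apply: measurableT_comp => //; exact: measurable_cons.
  have := IH (z \o S) (theta \o S) _ it mx (fun=> F0 _).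
  rewrite [X in _ = X -> _](_ : _ = \int[P]_w F2 (x, flat K (z \o S) w)).
    move=> <-; apply: eq_integral => w _; congr (F [tuple of _ :: _]).
    by apply: eq_from_tnth => k; rewrite !tnth_mktuple.
  apply: eq_integral => w _; congr (_ * (expR _)%:E).
  by apply: eq_bigr => k _; rewrite tnth_mktuple.
have [<- ->] := ge0_integral_indep_normal iz mF2 F20.
pose F3 (y : measurableTypeR R * K.-tuple R) :=
  F [tuple of y.1 :: y.2] * (L y.2)%:E *
  (expR (theta 0%N * y.1 - theta 0%N ^+ 2 / 2))%:E.
have mF3' : measurable_fun setT (fun y : measurableTypeR R * K.-tuple R =>
    F [tuple of y.1 :: y.2] * (L y.2)%:E).
  apply: emeasurable_funM.
    by apply: measurableT_comp => //; exact: measurable_cons.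
  by apply/measurable_EFinP; exact: measurableT_comp.
have mF3 : measurable_fun setT F3.
  apply: emeasurable_funM => //.
  by apply/measurable_EFinP; exact: (measurableT_comp me measurable_fst).
have F30 y : 0 <= F3 y by rewrite !mule_ge0// lee_fin expR_ge0.
transitivity (\int[P]_w \int[N01]_x F3 (x, flat K (z \o S) w)).
  apply: eq_integral => w _; set y := flat K _ w.
  apply: (@normal_prob_shift R (theta 0%N) (fun x => F [tuple of x :: y] * (L y)%:E)).
    have mp : measurable_fun [set: measurableTypeR R] (fun x => (x, y)).
      exact: measurable_fun_pair.
    exact: (measurableT_comp mF3' mp).
  by move=> x; rewrite mule_ge0// lee_fin expR_ge0.
have [_ <-] := ge0_integral_indep_normal iz mF3 F30.
apply: eq_integral => w _; rewrite /F3 /= -muleA -EFinM -expRD flatS.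
congr (_ * (expR _)%:E); rewrite [RHS]big_ord_recl addrC; congr (_ + _)%R.
by apply: eq_bigr => k _; rewrite tnth_mktuple.
Qed.

End cameron_martin.

Lemma big_ord_mul (R : Type) (idx : R) (op : Monoid.law idx) (L D : nat)
    (F : nat -> R) :
  \big[op/idx]_(k < L * D) F k =
  \big[op/idx]_(j < L) \big[op/idx]_(i < D) F (j * D + i)%N.
Proof.
elim: L => [|L IH]; first by rewrite mul0n !big_ord0.
rewrite big_ord_recr -IH /= mulSnr big_split_ord; congr (op _ _).
Qed.

(** * Change of means for the samples X, Y, Z *)

Section sample_shift.
Context {R : realType} {d : measure_display} {Omega : measurableType d}.
Variables (P : probability Omega R) (D : nat) (xi : nat -> 'I_D -> Omega -> R).
Hypotheses (Hxi : std_normal_family P xi) (HD : (0 < D)%N).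

Definition row_major k : Omega -> R := xi (k %/ D) (Ordinal (ltn_pmod k HD)).

Lemma row_majorE j (i : 'I_D) : row_major (j * D + i) = xi j i.
Proof.
rewrite /row_major divnMDl// divn_small// addn0; congr xi.
by apply: val_inj => /=; rewrite modnMDl modn_small.
Qed.

Lemma indep_row_major L : indep_normal P (L * D) row_major.
Proof.
have [mxi [lxi ixi]] := Hxi; split=> [k|A mA]; first exact: mxi.
transitivity (P [set w | forall j, (j < L)%N -> forall i : 'I_D, A (j * D + i)%N (xi j i w)]).
  congr (P _); apply/seteqP; split => w /= h.
    move=> j jL i; rewrite -row_majorE; apply: h.
    by rewrite (@leq_trans (j * D + D)) ?ltn_add2l// -mulSnr leq_mul2r jL orbT.
  move=> k kLD; have := h (k %/ D)%N _ (Ordinal (ltn_pmod k HD)).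
  by rewrite /= -divn_eq; apply; rewrite ltn_divLR.
rewrite (ixi L (fun j (i : 'I_D) => A (j * D + i)%N))//.
rewrite (big_ord_mul _ L D (fun k => normal_prob 0 1 (A k))).
by apply: eq_bigr => j _; apply: eq_bigr => i _; rewrite lxi.
Qed.

Definition rows L (y : nat -> 'I_D -> Omega -> R) w : L.-tuple (D.-tuple R) :=
  [tuple [tuple y j i w | i < D] | j < L].

Lemma rows_shift L (tau : nat -> 'I_D -> R) (F : L.-tuple (D.-tuple R) -> \bar R) :
  measurable_fun setT F -> (forall t, 0 <= F t)%E ->
  (\int[P]_w F (rows L (fun j i w => (tau j i + xi j i w)%R) w) =
   \int[P]_w (F (rows L xi w) *
     (expR (\sum_(j < L) \sum_(i < D) (tau j i * xi j i w - tau j i ^+ 2 / 2)))%:E))%E.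
Proof.
move=> mF F0.
have lt_LD (j : 'I_L) (i : 'I_D) : (j * D + i < L * D)%N.
  by rewrite (@leq_trans (j * D + D)) ?ltn_add2l// -mulSnr leq_mul2r ltn_ord orbT.
pose g (t : (L * D).-tuple R) : L.-tuple (D.-tuple R) :=
  [tuple [tuple tnth t (Ordinal (lt_LD j i)) | i < D] | j < L].
have mg : measurable_fun setT g.
  apply/measurable_fun_tnthP => j; apply/measurable_fun_tnthP => i.
  rewrite (_ : _ \o _ = fun t => tnth t (Ordinal (lt_LD j i))).
    exact: measurable_tnth.
  by apply/funext => t /=; rewrite !tnth_mktuple.
pose th k : R := tau (k %/ D)%N (Ordinal (ltn_pmod k HD)).
have thE j (i : 'I_D) : th (j * D + i)%N = tau j i.
  rewrite /th divnMDl// divn_small// addn0; congr tau.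
  by apply: val_inj => /=; rewrite modnMDl modn_small.
have := cameron_martin th (indep_row_major L) (measurableT_comp mF mg) (fun=> F0 _).
under eq_integral => w _.
  rewrite (_ : (F \o g) _ = F (rows L (fun j i w => (tau j i + xi j i w)%R) w)); last first.
    congr F; apply: eq_from_tnth => j; rewrite !tnth_mktuple.
    by apply: eq_from_tnth => i; rewrite !tnth_mktuple/= thE row_majorE.
  over.
move=> ->; apply: eq_integral => w _.
rewrite (big_ord_mul _ L D (fun k => th k * row_major k w - th k ^+ 2 / 2)).
congr (_ * (expR _)%:E)%E.
  congr F; apply: eq_from_tnth => j; rewrite !tnth_mktuple.
  by apply: eq_from_tnth => i; rewrite !tnth_mktuple/= row_majorE.
by apply: eq_bigr => j _; apply: eq_bigr => i _; rewrite thE row_majorE.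
Qed.

Variables n m : nat.

Definition lfht_sample (th1 th2 th : 'rV[R]_D) w :=
  (sample xi th1 0 n w, sample xi th2 n n w, sample xi th (n + n) m w).

Definition col_sum k l (i : 'I_D) w := \sum_(j < l) xi (k + j)%N i w.

(** The log-density of the three samples relative to pure noise is
    [lfht_exponent - lfht_energy / 2]: a linear form in the column sums, the sufficient statistics,
    minus half its variance. *)
Definition lfht_exponent (th1 th2 th : 'rV[R]_D) w :=
  \sum_(i < D) (th1 ord0 i * col_sum 0 n i w + th2 ord0 i * col_sum n n i w +
                th ord0 i * col_sum (n + n) m i w).

Definition lfht_energy (th1 th2 th : 'rV[R]_D) :=
  \sum_(i < D) (n%:R * th1 ord0 i ^+ 2 + n%:R * th2 ord0 i ^+ 2 +
                m%:R * th ord0 i ^+ 2).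

(** X, Y and Z occupy consecutive noise rows, so they are pieces of one array of [n + n + m] rows
    whose mean [tau] is constant on each piece; [rows_shift] then applies. *)
Lemma lfht_sample_shift th1 th2 th
    (F : n.-tuple (D.-tuple R) * n.-tuple (D.-tuple R) * m.-tuple (D.-tuple R) ->
         \bar R) :
  measurable_fun setT F -> (forall t, 0 <= F t)%E ->
  (\int[P]_w F (lfht_sample th1 th2 th w) =
   \int[P]_w (F (lfht_sample 0 0 0 w) *
     (expR (lfht_exponent th1 th2 th w - lfht_energy th1 th2 th / 2))%:E))%E.
Proof.
move=> mF F0.
pose g (t : (n + n + m).-tuple (D.-tuple R)) :
    n.-tuple (D.-tuple R) * n.-tuple (D.-tuple R) * m.-tuple (D.-tuple R) :=
  ([tuple tnth t (lshift m (lshift n j)) | j < n],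
   [tuple tnth t (lshift m (rshift n j)) | j < n],
   [tuple tnth t (rshift (n + n) j) | j < m]).
have mg : measurable_fun setT g.
  have mt k (f : 'I_k -> 'I_(n + n + m)) : measurable_fun setT
      (fun t : (n + n + m).-tuple (D.-tuple R) => [tuple tnth t (f j) | j < k]).
    apply/measurable_fun_tnthP => j; rewrite (_ : _ \o _ = fun t => tnth t (f j)).
      exact: measurable_tnth.
    by apply/funext => t /=; rewrite tnth_mktuple.
  apply: measurable_fun_pair; last exact: mt.
  by apply: measurable_fun_pair; exact: mt.
pose tau j (i : 'I_D) := if (j < n)%N then th1 ord0 i else
  if (j < n + n)%N then th2 ord0 i else th ord0 i.
have tau1 (j : 'I_n) i : tau j i = th1 ord0 i by rewrite /tau ltn_ord.
have tau2 (j : 'I_n) i : tau (n + j)%N i = th2 ord0 i.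
  by rewrite /tau ltnNge leq_addr/= ltn_add2l ltn_ord.
have tau3 (j : 'I_m) i : tau (n + n + j)%N i = th ord0 i.
  by rewrite /tau ltnNge -addnA leq_addr/= addnA ltnNge leq_addr.
have := rows_shift tau (measurableT_comp mF mg) (fun=> F0 _).
under eq_integral => w _.
  rewrite (_ : (F \o g) _ = F (lfht_sample th1 th2 th w)); last first.
    congr F; congr (_, _, _); apply: eq_from_tnth => j; rewrite !tnth_mktuple;
      apply: eq_from_tnth => i; rewrite !tnth_mktuple/=.
    - by rewrite tau1.
    - by rewrite tau2.
    - by rewrite tau3.
  over.
move=> ->; apply: eq_integral => w _; congr (_ * (expR _)%:E)%E.
  congr F; congr (_, _, _); apply: eq_from_tnth => j; rewrite !tnth_mktuple;
    by apply: eq_from_tnth => i; rewrite !tnth_mktuple/= mxE add0r.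
rewrite exchange_big /lfht_exponent /lfht_energy mulr_suml -sumrB.
apply: eq_bigr => i _; rewrite !big_split_ord /=.
under eq_bigr do rewrite tau1.
under [X in _ + X + _]eq_bigr do rewrite tau2.
under [X in _ + X]eq_bigr do rewrite tau3.
have sumE l (c : R) (f : 'I_l -> R) :
    \sum_(j < l) (c * f j - c ^+ 2 / 2) = c * (\sum_(j < l) f j) - l%:R * c ^+ 2 / 2.
  by rewrite sumrB -mulr_sumr sumr_const card_ord -[_ *+ l]mulr_natl mulrA.
by rewrite !sumE /col_sum; field.
Qed.

End sample_shift.

(** * Likelihoods and testing *)

Section expectation_value.
Context {R : realType} {d : measure_display} {Omega : measurableType d}.
Variable P : probability Omega R.

(** Integrability travels with the value, so that moments can be combined linearly without separate
    side conditions. *)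
Definition has_expectation (f : Omega -> R) (v : R) :=
  P.-integrable setT (EFin \o f) /\ (\int[P]_w (f w)%:E = v%:E)%E.

Lemma has_expectation_ge0 (f : Omega -> R) v : measurable_fun setT f ->
  (forall w, 0 <= f w) -> (\int[P]_w (f w)%:E = v%:E)%E -> has_expectation f v.
Proof.
move=> mf f0 fv; split => //; apply/integrableP; split.
  exact/measurable_EFinP.
under eq_integral do rewrite /= ger0_norm//.
by rewrite fv ltry.
Qed.

Lemma has_expectation_cst (c : R) : has_expectation (fun=> c) c.
Proof.
split; first by apply/finite_measure_integrable_cst.
by rewrite integral_cst//= probability_setT mule1.
Qed.

Lemma has_expectationD f g v v' : has_expectation f v -> has_expectation g v' ->
  has_expectation (fun w => f w + g w) (v + v').
Proof.
move=> [fi fv] [gi gv]; split; first exact: (integrableD _ fi gi).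
by under eq_integral do rewrite EFinD; rewrite integralD// fv gv.
Qed.

Lemma has_expectationZ c f v : has_expectation f v ->
  has_expectation (fun w => c * f w) (c * v).
Proof.
move=> [fi fv]; split; first exact: (integrableZl _ c fi).
by under eq_integral do rewrite EFinM; rewrite integralZl// fv.
Qed.

Lemma has_expectation_sum (I : Type) (s : seq I) (f : I -> Omega -> R) v :
  (forall i, has_expectation (f i) (v i)) ->
  has_expectation (fun w => \sum_(i <- s) f i w) (\sum_(i <- s) v i).
Proof.
move=> fv; elim: s => [|i s IH].
  rewrite big_nil (_ : (fun w => _) = fun=> 0); first exact: has_expectation_cst.
  by apply/funext => w; rewrite big_nil.
rewrite big_cons (_ : (fun w => _) = fun w => f i w + \sum_(j <- s) f j w).
  exact: has_expectationD.
by apply/funext => w; rewrite big_cons.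
Qed.

Lemma le_has_expectation f g v v' : has_expectation f v -> has_expectation g v' ->
  (forall w, f w <= g w) -> v <= v'.
Proof.
move=> [fi fv] [gi gv] fg; rewrite -lee_fin -fv -gv.
by apply: le_integral => // w _; rewrite /= lee_fin.
Qed.

Lemma eq_has_expectation f g v v' : has_expectation f v -> f =1 g -> v = v' ->
  has_expectation g v'.
Proof. by move=> fv /funext <- <-. Qed.

End expectation_value.

Section likelihood.
Context {R : realType} {d : measure_display} {Omega : measurableType d}.
Variables (P : probability Omega R) (D : nat) (xi : nat -> 'I_D -> Omega -> R).
Hypotheses (Hxi : std_normal_family P xi) (HD : (0 < D)%N).
Variables n m : nat.

Local Notation exponent := (lfht_exponent xi n m).
Local Notation energy := (@lfht_energy R D n m).

Lemma measurable_col_sum k l i : measurable_fun setT (col_sum xi k l i).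
Proof. by have [mxi _] := Hxi; apply: measurable_sum => j; exact: mxi. Qed.

Lemma measurable_lfht_exponent th1 th2 th : measurable_fun setT (exponent th1 th2 th).
Proof.
apply: measurable_sum => i; have mc := measurable_col_sum.
by do 2?[apply: measurable_funD]; apply: measurable_funM.
Qed.

Lemma measurable_lfht_sample th1 th2 th :
  measurable_fun setT (lfht_sample xi n m th1 th2 th).
Proof.
have [mxi _] := Hxi.
have ms t k l : measurable_fun setT (sample xi t k l).
  apply/measurable_fun_tnthP => j; apply/measurable_fun_tnthP => i.
  rewrite (_ : _ \o _ = fun w => t ord0 i + xi (k + j)%N i w).
    exact: measurable_funD.
  by apply/funext => w /=; rewrite !tnth_mktuple.
apply: measurable_fun_pair; last exact: ms.
by apply: measurable_fun_pair; exact: ms.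
Qed.

Definition likelihood th1 th2 th w := expR (exponent th1 th2 th w - energy th1 th2 th / 2).

Lemma measurable_likelihood th1 th2 th : measurable_fun setT (likelihood th1 th2 th).
Proof.
apply: measurableT_comp => //; apply: measurable_funB => //.
exact: measurable_lfht_exponent.
Qed.

(** The change of means applied to an indicator: probabilities at all parameter values become
    expectations over the same pure-noise sample, where they can be averaged and compared. *)
Lemma likelihood_event th1 th2 th (E : set (n.-tuple (D.-tuple R) *
    n.-tuple (D.-tuple R) * m.-tuple (D.-tuple R))) (mE : measurable E) :
  has_expectation P
    (fun w => \1_E (lfht_sample xi n m 0 0 0 w) * likelihood th1 th2 th w)
    (fine (P (lfht_sample xi n m th1 th2 th @^-1` E))).
Proof.
have ms := measurable_lfht_sample.
have mSE : measurable (lfht_sample xi n m th1 th2 th @^-1` E).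
  by rewrite -[X in measurable X]setTI; exact: ms.
apply: has_expectation_ge0.
- apply: measurable_funM; last exact: measurable_likelihood.
  have mI : measurable_fun setT (\1_E : _ -> R) by exact: measurable_indic.
  exact: (measurableT_comp mI (ms 0 0 0)).
- by move=> w; rewrite mulr_ge0 ?expR_ge0.
rewrite fineK ?fin_num_measure//.
have := lfht_sample_shift Hxi HD th1 th2 th (F := fun t => (\1_E t)%:E).
move=> <-//; first by rewrite -[in RHS](setIT (_ @^-1` _)) -integral_indic.
- exact/measurable_EFinP/measurable_indic.
Qed.

Lemma likelihood1 th1 th2 th : has_expectation P (likelihood th1 th2 th) 1.
Proof.
apply: (eq_has_expectation (likelihood_event th1 th2 th measurableT)).
  by move=> w; rewrite indicT mul1r.
by rewrite preimage_setT probability_setT.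
Qed.

(** A likelihood has mean 1 and differs from this exponential by a constant factor. The explicit
    moments of the priors and of the thresholding risk all reduce to this formula. *)
Lemma mgf_lfht th1 th2 th :
  has_expectation P (fun w => expR (exponent th1 th2 th w)) (expR (energy th1 th2 th / 2)).
Proof.
apply: (eq_has_expectation (has_expectationZ (expR (energy th1 th2 th / 2)) (likelihood1 th1 th2 th))).
  by move=> w; rewrite -expRD addrC subrK.
by rewrite mulr1.
Qed.

(* Integrating |f0 - f1| <= (q + h) / 2 against the test gives
   1 <= E|f0 - f1| <= (1 + W) / 2 for the prior-averaged likelihoods. *)
Lemma lfht_feasible_le (G : set 'rV[R]_D) (eps : R) (S : finType)
    (t1 t2 t1' t2' : S -> 'rV[R]_D) (q h : Omega -> R) W :
  lfht_feasible P xi G eps m n -> (0 < #|S|)%N ->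
  (forall s, [/\ G (t1 s), G (t2 s) & eps <= l2norm (t1 s - t2 s)]) ->
  (forall s, [/\ G (t1' s), G (t2' s) & eps <= l2norm (t1' s - t2' s)]) ->
  has_expectation P q 1 -> has_expectation P h W ->
  (forall w, `|#|S|%:R^-1 * \sum_s likelihood (t1 s) (t2 s) (t1 s) w -
              #|S|%:R^-1 * \sum_s likelihood (t1' s) (t2' s) (t2' s) w|
             <= (q w + h w) / 2) ->
  1 <= W.
Proof.
move=> [psi [mpsi Hpsi]] S0 H0 H1 Eq Eh qh.
have mE b : measurable (psi @^-1` [set b]).
  by rewrite -[X in measurable X]setTI; exact: mpsi.
set f0 := fun w => #|S|%:R^-1 * \sum_s likelihood (t1 s) (t2 s) (t1 s) w.
set f1 := fun w => #|S|%:R^-1 * \sum_s likelihood (t1' s) (t2' s) (t2' s) w.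
have SV v : #|S|%:R^-1 * \sum_(s : S) v = v :> R.
  by rewrite sumr_const -[v *+ _]mulr_natl mulKf// pnatr_eq0 -lt0n.
have Ef0 : has_expectation P f0 1.
  rewrite -[1]SV; apply: has_expectationZ; apply: has_expectation_sum => s.
  exact: likelihood1.
have Ef1 : has_expectation P f1 1.
  rewrite -[1]SV; apply: has_expectationZ; apply: has_expectation_sum => s.
  exact: likelihood1.
pose I b w : R := \1_(psi @^-1` [set b]) (lfht_sample xi n m 0 0 0 w).
have IE b w : I b w = (psi (lfht_sample xi n m 0 0 0 w) == b)%:R.
  rewrite /I indicE; congr (nat_of_bool _)%:R; apply/idP/eqP.
    by rewrite inE.
  by move=> <-; rewrite inE.
have [v0 [Ev0 v0le]] : exists v, has_expectation P (fun w => I true w * f0 w) v /\ v <= 1 / 4.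
  pose v s := fine (P (lfht_sample xi n m (t1 s) (t2 s) (t1 s) @^-1` (psi @^-1` [set true]))).
  exists (#|S|%:R^-1 * \sum_s v s); split.
    have := has_expectationZ #|S|%:R^-1 (has_expectation_sum (index_enum S)
      (fun s => likelihood_event (t1 s) (t2 s) (t1 s) (mE true))).
    move=> h1; apply: (eq_has_expectation h1) => [w|//].
    by rewrite /f0 mulrCA -mulr_sumr.
  rewrite -[leRHS]SV ler_wpM2l ?invr_ge0// ler_sum// => s _.
  have [G1 G2 e12] := H0 s; have [+ _] := Hpsi _ _ G1 G2 e12.
  rewrite -lee_fin fineK; last first.
    by rewrite fin_num_measure// -[X in measurable X]setTI; exact: measurable_lfht_sample.
  congr (_ <= _)%E; congr (P _); apply/seteqP; split => w /=.
    by rewrite /lfht_sample; case: (psi _).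
  by rewrite /lfht_sample => ->.
have [v1 [Ev1 v1le]] : exists v, has_expectation P (fun w => I false w * f1 w) v /\ v <= 1 / 4.
  pose v s := fine (P (lfht_sample xi n m (t1' s) (t2' s) (t2' s) @^-1` (psi @^-1` [set false]))).
  exists (#|S|%:R^-1 * \sum_s v s); split.
    have := has_expectationZ #|S|%:R^-1 (has_expectation_sum (index_enum S)
      (fun s => likelihood_event (t1' s) (t2' s) (t2' s) (mE false))).
    move=> h1; apply: (eq_has_expectation h1) => [w|//].
    by rewrite /f1 mulrCA -mulr_sumr.
  rewrite -[leRHS]SV ler_wpM2l ?invr_ge0// ler_sum// => s _.
  have [G1 G2 e12] := H1 s; have [_ +] := Hpsi _ _ G1 G2 e12.
  rewrite -lee_fin fineK; last first.
    by rewrite fin_num_measure// -[X in measurable X]setTI; exact: measurable_lfht_sample.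
  congr (_ <= _)%E; congr (P _); apply/seteqP; split => w /=.
    by rewrite /lfht_sample; case: (psi _).
  by rewrite /lfht_sample => ->.
have := le_has_expectation (has_expectationD Ef0 Ef1)
  (has_expectationD (has_expectationZ 2 (has_expectationD Ev0 Ev1))
     (has_expectationZ (1 / 2) (has_expectationD Eq Eh))).
(* Where [psi] answers [true], f0 + f1 = 2 f0 + (f1 - f0), and 2 f0 counts towards the error under
   the first hypothesis; the other case is symmetric. In expectation this reads 2 <= 2 * (1/4 + 1/4)
   + (1 + W) / 2. *)
have pw w : f0 w + f1 w <= 2 * (I true w * f0 w + I false w * f1 w) +
    1 / 2 * (q w + h w).
  have := qh w; rewrite -/(f0 w) -/(f1 w) ler_norml !IE.
  by case: (psi _); rewrite /= ?mul1r ?mul0r; lra.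
move=> /(_ pw); lra.
Qed.

End likelihood.

(** * A chi-square type bound for the difference of two product densities *)

Section product_inequality.
Context {R : realType}.

Lemma ge_prod_onem (I : Type) (s : seq I) (t : I -> R) :
  (forall i, 0 <= t i <= 1) ->
  1 - \sum_(i <- s) t i <= \prod_(i <- s) (1 - t i) <= 1.
Proof.
move=> t01; elim: s => [|i s IH]; first by rewrite !big_nil; lra.
rewrite !big_cons; have := t01 i.
set a := \sum_(j <- s) _ in IH *; set b := \prod_(j <- s) _ in IH *.
by nra.
Qed.

(** Expand the square of the difference. Blockwise (q + p)^2 <= q (q + 2p + r), likewise with -p,
    and the cross term is the product of the q^2 - p^2, at least Q^2 (1 - sum of r/q). Hence (F0 -
    F1)^2 <= Q H, and the arithmetic-geometric mean inequality gives (Q + H) / 2, whose terms all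
    have computable expectation. *)
Lemma prod_perturbation (B : finType) (q p r : B -> R) :
  (forall b, 0 < q b) -> (forall b, `|p b| <= q b) ->
  (forall b, p b ^+ 2 <= q b * r b) ->
  `|\prod_b (q b + p b) - \prod_b (q b - p b)| <=
  (\prod_b q b + (\prod_b (q b + 2 * p b + r b) + \prod_b (q b - 2 * p b + r b)
   - 2 * \prod_b q b
   + 2 * \sum_b \prod_c (if c == b then r c else q c))) / 2.
Proof.
move=> q0 pq pr.
set Q := \prod_b q b; set H1 := \prod_b (q b + 2 * p b + r b).
set H2 := \prod_b (q b - 2 * p b + r b); set T := \sum_b _.
set F0 := \prod_b (q b + p b); set F1 := \prod_b (q b - p b).
have Q0 : 0 < Q by rewrite prodr_gt0.
have F0H : F0 ^+ 2 <= Q * H1.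
  rewrite -prodrXl -big_split ler_prod// => b _; rewrite sqr_ge0/=.
  by have := pr b; nra.
have F1H : F1 ^+ 2 <= Q * H2.
  rewrite -prodrXl -big_split ler_prod// => b _; rewrite sqr_ge0/=.
  by have := pr b; nra.
have F01 : Q ^+ 2 - Q * T <= F0 * F1.
  pose t b := (p b / q b) ^+ 2.
  have t01 b : 0 <= t b <= 1.
    rewrite /t sqr_ge0/= -real_normK ?num_real// exprn_ile1//.
    by rewrite normrM normfV (gtr0_norm (q0 b)) ler_pdivrMr// mul1r.
  have -> : F0 * F1 = Q ^+ 2 * \prod_b (1 - t b).
    rewrite -prodrXl -!big_split; apply: eq_bigr => b _ /=.
    by rewrite /t; field; rewrite gt_eqF.
  (* Each summand of [T] is [Q] with one factor [q b] replaced by [r b], that is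
     [Q * (r b / q b)]. *)
  have -> : Q ^+ 2 - Q * T = Q ^+ 2 * (1 - \sum_b r b / q b).
    rewrite mulrBr mulr1 expr2 -mulrA; congr (_ - Q * _).
    rewrite mulr_sumr; apply: eq_bigr => b _.
    rewrite (bigD1 b)//= eqxx /Q [in RHS](bigD1 b)//=.
    have -> : \prod_(i | i != b) (if i == b then r i else q i) = \prod_(i | i != b) q i.
      by apply: eq_bigr => c /negbTE ->.
    by field; rewrite gt_eqF.
  rewrite ler_pM2l ?exprn_gt0//.
  have /andP[+ _] := ge_prod_onem (index_enum B) t01.
  apply: le_trans; rewrite lerD2l lerN2 ler_sum// => b _.
  rewrite /t exprMn exprVn ler_pdivrMr ?exprn_gt0//.
  apply: le_trans (pr b) _; rewrite expr2 mulrA divfK ?gt_eqF//.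
  by rewrite mulrC.
pose H := H1 + H2 - 2 * Q + 2 * T.
have FH : (F0 - F1) ^+ 2 <= Q * H by rewrite /H; nra.
rewrite -/H.
have H0 : 0 <= H by rewrite -(pmulr_rge0 _ Q0) (le_trans (sqr_ge0 _) FH).
rewrite -(@ler_pXn2r _ 2) ?nnegrE//; last by lra.
rewrite real_normK ?num_real//; apply: le_trans FH _.
by have := sqr_ge0 (Q - H); nra.
Qed.

End product_inequality.

(** * Parameters scaled blockwise, and moments of products over blocks *)

Section blocks.
Context {R : realType} {d : measure_display} {Omega : measurableType d}.
Variables (P : probability Omega R) (D : nat) (xi : nat -> 'I_D -> Omega -> R).
Hypotheses (Hxi : std_normal_family P xi) (HD : (0 < D)%N).
Variables n m : nat.
Variables (a : 'rV[R]_D) (B : finType) (bl : 'I_D -> B).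

(** Coordinates with the same value of [bl] share one factor: [id] lets every coordinate have its
    own sign, a constant map imposes a common sign. *)
Definition block_scale (c : B -> R) : 'rV[R]_D := \row_i (c (bl i) * a ord0 i).

Definition block_sq b := \sum_(i < D | bl i == b) a ord0 i ^+ 2.

Definition block_sum k l b w := \sum_(i < D | bl i == b) a ord0 i * col_sum xi k l i w.

Local Notation X := (block_sum 0 n).
Local Notation Y := (block_sum n n).
Local Notation Z := (block_sum (n + n) m).

Lemma lfht_exponent_block c1 c2 c3 w :
  lfht_exponent xi n m (block_scale c1) (block_scale c2) (block_scale c3) w =
  \sum_b (c1 b * X b w + c2 b * Y b w + c3 b * Z b w).
Proof.
rewrite /lfht_exponent (partition_big bl xpredT)//=; apply: eq_bigr => b _.
rewrite /block_sum !mulr_sumr -!big_split/=; apply: eq_bigr => i /eqP <-.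
by rewrite !mxE !mulrA.
Qed.

Lemma lfht_energy_block c1 c2 c3 :
  lfht_energy n m (block_scale c1) (block_scale c2) (block_scale c3) =
  \sum_b block_sq b * (n%:R * c1 b ^+ 2 + n%:R * c2 b ^+ 2 + m%:R * c3 b ^+ 2).
Proof.
rewrite /lfht_energy (partition_big bl xpredT)//=; apply: eq_bigr => b _.
rewrite /block_sq mulr_suml; apply: eq_bigr => i /eqP <-.
by rewrite !mxE; ring.
Qed.

Lemma expectation_block_prod (J : finType) (e1 e2 e3 : J -> R) (c : B -> J -> R) :
  has_expectation P
    (fun w => \prod_b \sum_j c b j * expR (e1 j * X b w + e2 j * Y b w + e3 j * Z b w))
    (\prod_b \sum_j c b j *
      expR (block_sq b * (n%:R * e1 j ^+ 2 + n%:R * e2 j ^+ 2 + m%:R * e3 j ^+ 2) / 2)).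
Proof.
rewrite bigA_distr_bigA/=.
have := has_expectation_sum (index_enum {ffun B -> J}) (fun f : {ffun B -> J} =>
  has_expectationZ (\prod_b c b (f b)) (mgf_lfht Hxi HD n m (block_scale (e1 \o f))
     (block_scale (e2 \o f)) (block_scale (e3 \o f)))).
move=> h; apply: (eq_has_expectation h) => [w|].
  rewrite bigA_distr_bigA/=; apply: eq_bigr => f _.
  by rewrite lfht_exponent_block expR_sum -big_split.
apply: eq_bigr => f _.
by rewrite lfht_energy_block mulr_suml expR_sum -big_split.
Qed.

End blocks.

(** * Hyperbolic functions *)

Section hyperbolic.
Context {R : realType}.

Definition ch (x : R) := (expR x + expR (- x)) / 2.
Definition sh (x : R) := (expR x - expR (- x)) / 2.

Lemma ch_gt0 x : 0 < ch x.
Proof. by rewrite /ch; have := expR_gt0 x; have := expR_gt0 (- x); lra. Qed.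

Lemma ch2_sh2 x : ch x ^+ 2 = sh x ^+ 2 + 1.
Proof. by have := expRxMexpNx_1 x; rewrite /ch /sh; nra. Qed.

Lemma norm_sh_le_ch x : `|sh x| <= ch x.
Proof.
rewrite ler_norml /sh /ch.
by have := expR_gt0 x; have := expR_gt0 (- x); move=> h1 h2; apply/andP; split; lra.
Qed.

Lemma chD x y : ch (x + y) = ch x * ch y + sh x * sh y.
Proof. by rewrite /ch /sh opprD !expRD; field. Qed.

Lemma chB x y : ch (x - y) = ch x * ch y - sh x * sh y.
Proof. by rewrite /ch /sh opprB !expRD; field. Qed.

(** The right side equals ch^2 - 1 + (1 - t ch)^2. *)
Lemma sh2_le_ch x t : sh x ^+ 2 <= ch x * ((1 + t ^+ 2) * ch x - 2 * t).
Proof.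
by have := ch2_sh2 x; have := sqr_ge0 (1 - t * ch x); nra.
Qed.

End hyperbolic.

(** * Random-sign priors and their mixture likelihoods *)

Section priors.
Context {R : realType} {d : measure_display} {Omega : measurableType d}.
Variables (P : probability Omega R) (D : nat) (xi : nat -> 'I_D -> Omega -> R).
Hypotheses (Hxi : std_normal_family P xi) (HD : (0 < D)%N).
Variables n m : nat.
Variables (a : 'rV[R]_D) (B : finType) (bl : 'I_D -> B).

Local Notation X := (block_sum xi a bl 0 n).
Local Notation Y := (block_sum xi a bl n n).
Local Notation Z := (block_sum xi a bl (n + n) m).
Local Notation A := (block_sq a bl).

Definition sgb (t : bool) : R := if t then 1 else -1.

Definition signed k (s : {ffun B -> bool}) := block_scale a bl (fun b => k * sgb (s b)).

(** For a fixed sign pattern the likelihood is a product over blocks, so the average over all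
    patterns factors, and each two-point average is a hyperbolic cosine. *)
Lemma mean_likelihood_signed k1 k2 k3 w :
  #|{ffun B -> bool}|%:R^-1 * \sum_(s : {ffun B -> bool})
    likelihood xi n m (signed k1 s) (signed k2 s) (signed k3 s) w =
  \prod_b (expR (- (A b * (n%:R * k1 ^+ 2 + n%:R * k2 ^+ 2 + m%:R * k3 ^+ 2) / 2)) *
           ch (k1 * X b w + k2 * Y b w + k3 * Z b w)).
Proof.
pose v b := k1 * X b w + k2 * Y b w + k3 * Z b w.
pose e b := A b * (n%:R * k1 ^+ 2 + n%:R * k2 ^+ 2 + m%:R * k3 ^+ 2) / 2.
have LE s : likelihood xi n m (signed k1 s) (signed k2 s) (signed k3 s) w =
    \prod_b expR (sgb (s b) * v b - e b).
  rewrite /likelihood lfht_exponent_block lfht_energy_block -expR_sum mulr_suml -sumrB.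
  congr expR; apply: eq_bigr => b _; rewrite /v /e.
  by rewrite /sgb; case: (s b); field.
rewrite (eq_bigr _ (fun s _ => LE s)).
rewrite -(bigA_distr_bigA (fun b t => expR (sgb t * v b - e b))).
rewrite card_ffun card_bool natrX -exprVn -prodr_const -big_split.
apply: eq_bigr => b _; rewrite big_bool /= mul1r mulN1r -/(v b) -/(e b) /ch.
by rewrite (expRD (v b)) (expRD (- v b)); field.
Qed.

(* [qf] is the reference density q, [pf = q t] and [rf >= q t^2]; [rf] replaces
   [tanh x * sinh x] by [(1 + c^2) cosh x - 2 c], an upper bound for every [c]
   that is sharp on average when [c] is the inverse mean of [cosh x]. *)
Definition tau b : R := expR (- (n%:R * A b)).
Definition sig b : R := expR (- (m%:R * A b / 2)).

Definition qf b w := tau b * sig b * (ch (X b w - Y b w) * ch (Z b w)).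
Definition pf b w := tau b * sig b * (sh (X b w - Y b w) * sh (Z b w)).
Definition rf b w := tau b * sig b *
  (((1 + tau b ^+ 2) * ch (X b w - Y b w) - 2 * tau b) *
   ((1 + sig b ^+ 2) * ch (Z b w) - 2 * sig b)).
Definition cf b := (1 - tau b ^+ 2) * (1 - sig b ^+ 2).

(** Blockwise [qf], [pf] and [rf] have means 1, 0 and [cf]. The coefficients are left free because
    every product on the right of [prod_perturbation] has this form. *)
Lemma expectation_qpr (la nu ro : B -> R) :
  has_expectation P
    (fun w => \prod_b (la b * qf b w + nu b * pf b w + ro b * rf b w))
    (\prod_b (la b + ro b * cf b)).
Proof.
(* [cv], [sv] and [rv t] are the coefficients of ch x, sh x and (1 + t^2) ch x - 2 t on the
   exponentials of x, -x and 0. *)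
pose e (i : 'I_3) : R := [:: 1; -1; 0]`_i.
pose cv (i : 'I_3) : R := [:: 1 / 2; 1 / 2; 0]`_i.
pose sv (i : 'I_3) : R := [:: 1 / 2; - (1 / 2); 0]`_i.
pose rv t (i : 'I_3) : R := [:: (1 + t ^+ 2) / 2; (1 + t ^+ 2) / 2; - (2 * t)]`_i.
pose c b (j : 'I_3 * 'I_3) := tau b * sig b *
  (la b * (cv j.1 * cv j.2) + nu b * (sv j.1 * sv j.2) +
   ro b * (rv (tau b) j.1 * rv (sig b) j.2)).
have := expectation_block_prod Hxi HD n m a bl (fun j => e j.1) (fun j => - e j.1)
  (fun j => e j.2) c.
move=> h; apply: (eq_has_expectation h) => [w|].
  apply: eq_bigr => b _.
  have -> : \sum_(j : 'I_3 * 'I_3) c b j * expR (e j.1 * X b w + - e j.1 * Y b w +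
      e j.2 * Z b w) =
    \sum_(i < 3) \sum_(j < 3) c b (i, j) * (expR (e i * (X b w - Y b w)) *
      expR (e j * Z b w)).
    rewrite pair_bigA/=; apply: eq_bigr => -[i j] _; rewrite -expRD.
    by congr (_ * expR _) => /=; ring.
  rewrite !big_ord_recl !big_ord0 /c /e /cv /sv /rv /= !mul1r !mulN1r !mul0r expR0.
  by rewrite /qf /pf /rf /ch /sh; field.
apply: eq_bigr => b _.
have -> : \sum_(j : 'I_3 * 'I_3) c b j * expR (A b * (n%:R * e j.1 ^+ 2 +
    n%:R * (- e j.1) ^+ 2 + m%:R * e j.2 ^+ 2) / 2) =
  \sum_(i < 3) \sum_(j < 3) c b (i, j) * (expR (n%:R * A b * e i ^+ 2) *
    expR (m%:R * A b / 2 * e j ^+ 2)).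
  rewrite pair_bigA/=; apply: eq_bigr => -[i j] _; rewrite -expRD.
  by congr (_ * expR _) => /=; field.
rewrite !big_ord_recl !big_ord0 /c /e /cv /sv /rv /= !sqrrN expr1n expr0n/= !mulr1 !mulr0 expR0.
rewrite /cf /tau /sig !expRN.
by field; rewrite !gt_eqF ?expR_gt0.
Qed.

Lemma qf_gt0 b w : 0 < qf b w.
Proof.
apply: mulr_gt0; last by apply: mulr_gt0; exact: ch_gt0.
by apply: mulr_gt0; exact: expR_gt0.
Qed.

Lemma norm_pf_le b w : `|pf b w| <= qf b w.
Proof.
have ts0 : 0 <= tau b * sig b by apply: mulr_ge0; exact: expR_ge0.
rewrite /pf /qf normrM (ger0_norm ts0); apply: ler_wpM2l => //.
rewrite (normrM (sh _) (sh _)).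
by apply: ler_pM; rewrite ?normr_ge0// norm_sh_le_ch.
Qed.

Lemma pf2_le b w : pf b w ^+ 2 <= qf b w * rf b w.
Proof.
rewrite /pf /qf /rf.
set x := X b w - Y b w; set z := Z b w.
rewrite (_ : _ * _ * (tau b * sig b * _) = (tau b * sig b) ^+ 2 *
  ((ch x * ((1 + tau b ^+ 2) * ch x - 2 * tau b)) *
   (ch z * ((1 + sig b ^+ 2) * ch z - 2 * sig b)))); last by ring.
rewrite exprMn ler_wpM2l ?sqr_ge0// exprMn.
by apply: ler_pM; rewrite ?sqr_ge0// sh2_le_ch.
Qed.

Variables (G : set 'rV[R]_D) (eps : R).
Hypotheses (Gorth : orthosymmetric G) (Ga : G a).
Hypothesis Hfeas : lfht_feasible P xi G eps m n.

Lemma signed_in k s : k = 1 \/ k = -1 -> G (signed k s).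
Proof.
move=> k1.
have := Gorth Ga (fun i => k * sgb (s (bl i)) == -1).
congr G; apply/rowP => i; rewrite !mxE /sgb.
case: k1 => ->; case: (s _); rewrite ?mulrN ?mulN1r ?mul1r ?opprK ?eqxx ?mulN1r ?mul1r//.
- by rewrite -subr_eq0 opprK (_ : 1 + 1 = 2)// (eqr_nat R 2 0)/=.
- by rewrite -subr_eq0 opprK (_ : 1 + 1 = 2)// (eqr_nat R 2 0)/=.
Qed.

Lemma l2norm_signedB k k' s : l2norm (signed k s - signed k' s) = `|k - k'| * l2norm a.
Proof.
rewrite /l2norm -sqrtr_sqr -sqrtrM ?sqr_ge0//; congr Num.sqrt.
rewrite mulr_sumr; apply: eq_bigr => i _; rewrite !mxE /sgb.
by case: (s _); ring.
Qed.

Let cardS : (0 < #|{ffun B -> bool}|)%N.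
Proof. by apply/card_gt0P; exists [ffun=> true]. Qed.

(** The parameters are [s a] and [- s a], at distance twice the norm of [a]. The mixture likelihoods
    are the products of [qf + pf] and [qf - pf], so [prod_perturbation] feeds [lfht_feasible_le];
    half of the resulting inequality is the claim. *)
Lemma lfht_opposite_lower_bound : eps <= 2 * l2norm a ->
  1 / 2 <= \prod_b (1 + cf b) - 1 + \sum_b cf b.
Proof.
move=> ea.
pose h w := \prod_b (qf b w + 2 * pf b w + rf b w) +
   \prod_b (qf b w - 2 * pf b w + rf b w) - 2 * \prod_b qf b w
   + 2 * \sum_b \prod_c (if c == b then rf c w else qf c w).
have Eq : has_expectation P (fun w => \prod_b qf b w) 1.
  apply: (eq_has_expectation (expectation_qpr (fun=> 1) (fun=> 0) (fun=> 0))).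
    by move=> w; apply: eq_bigr => b _; rewrite mul1r !mul0r !addr0.
  by rewrite big1// => b _; rewrite mul0r addr0.
have Eh : has_expectation P h (\prod_b (1 + cf b) + \prod_b (1 + cf b) - 2 * 1 +
    2 * \sum_b cf b).
  apply: has_expectationD; last apply: has_expectationZ.
    rewrite -mulNr.
    apply: (eq_has_expectation (has_expectationD (has_expectationD
      (expectation_qpr (fun=> 1) (fun=> 2) (fun=> 1))
      (expectation_qpr (fun=> 1) (fun=> -2) (fun=> 1))) (has_expectationZ (-2) Eq))) => [w|].
      rewrite mulNr; congr (_ + _ - _); apply: eq_bigr => b _; ring.
    by congr (_ + _ + _); apply: eq_bigr => b _; rewrite mul1r.
  apply: has_expectation_sum => b.
  apply: (eq_has_expectation (expectation_qpr (fun c => (c != b)%:R) (fun=> 0)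
     (fun c => (c == b)%:R))) => [w|].
    apply: eq_bigr => c _; case: eqP => _ /=; ring.
  rewrite (bigD1 b)//= eqxx/= add0r mul1r big1 ?mulr1// => c /negbTE ->.
  by rewrite mul0r addr0.
have sep k k' s : `|k - k'| = 2 -> eps <= l2norm (signed k s - signed k' s).
  by move=> kk; rewrite l2norm_signedB kk.
have n2 : `|1 - -1| = 2 :> R by rewrite opprK ger0_norm//; lra.
have n2' : `|-1 - 1| = 2 :> R by rewrite distrC.
(* Under the second hypothesis X and Y exchange signs, so Z has mean [s a] under both. The arguments
   of ch are then Z + (X - Y) and Z - (X - Y), to which the addition formulas apply. *)
have := @lfht_feasible_le R d Omega P D xi Hxi HD n m G eps {ffun B -> bool}
  (signed 1) (signed (-1)) (signed (-1)) (signed 1) _ h _ Hfeas cardS _ _ Eq Eh.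
have -> : (1 / 2 <= \prod_b (1 + cf b) - 1 + \sum_b cf b) =
  (1 <= \prod_b (1 + cf b) + \prod_b (1 + cf b) - 2 * 1 + 2 * \sum_b cf b).
  by apply/idP/idP; lra.
apply.
- by move=> s; split; [apply: signed_in; left|apply: signed_in; right|exact: sep].
- by move=> s; split; [apply: signed_in; right|apply: signed_in; left|exact: sep].
move=> w; rewrite !mean_likelihood_signed.
apply: le_trans (prod_perturbation (fun b => qf_gt0 b w) (fun b => norm_pf_le b w)
  (fun b => pf2_le b w)).
rewrite le_eqVlt; apply/orP; left; apply/eqP; congr (`|_ - _|); apply: eq_bigr => b _.
  rewrite !mul1r mulN1r chD /qf /pf -[in RHS]mulrDr /tau /sig -expRD.
  by congr (expR _ * _); field.
rewrite (_ : -1 * X b w + 1 * Y b w + 1 * Z b w = Z b w - (X b w - Y b w)); last by ring.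
rewrite chB [ch _ * ch _]mulrC [sh _ * sh _]mulrC /qf /pf -[in RHS]mulrBr /tau /sig -expRD.
by congr (expR _ * _); field.
Qed.

(** The square of ch v is a combination of the exponentials of 2v, -2v and 0, whence the nodes [e].
    The condition on [k1], [k2] gives v variance [n * A b]. *)
Lemma expectation_ch_prod_sq k1 k2 : k1 ^+ 2 + k2 ^+ 2 = 1 ->
  has_expectation P
    (fun w => (\prod_b (expR (- (n%:R * A b / 2)) * ch (k1 * X b w + k2 * Y b w))) ^+ 2)
    (\prod_b ch (n%:R * A b)).
Proof.
move=> k12.
pose e (i : 'I_3) : R := [:: 2; -2; 0]`_i.
pose cv (i : 'I_3) : R := [:: 1 / 4; 1 / 4; 1 / 2]`_i.
have := expectation_block_prod Hxi HD n m a bl (fun j => k1 * e j) (fun j => k2 * e j)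
  (fun=> 0) (fun b j => expR (- (n%:R * A b)) * cv j).
move=> h; apply: (eq_has_expectation h) => [w|].
  rewrite -prodrXl; apply: eq_bigr => b _; pose v := k1 * X b w + k2 * Y b w.
  rewrite (eq_bigr (fun j => expR (- (n%:R * A b)) * cv j * expR (e j * v))); last first.
    by move=> j _; congr (_ * expR _); rewrite /v; ring.
  rewrite !big_ord_recl !big_ord0 /e /cv /= -/v mul0r expR0 mulNr -mulrN.
  have -> : expR (- (n%:R * A b)) = expR (- (n%:R * A b / 2)) ^+ 2.
    by rewrite -expRM_natl; congr expR; field.
  rewrite !expRM_natl (expRN v) /ch -/v (expRN v).
  by field; rewrite gt_eqF ?expR_gt0.
apply: eq_bigr => b _.
rewrite (eq_bigr (fun j => expR (- (n%:R * A b)) * cv j *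
    expR (n%:R * A b / 2 * e j ^+ 2))); last first.
  move=> j _; congr (_ * expR _).
  transitivity (A b * n%:R * e j ^+ 2 * (k1 ^+ 2 + k2 ^+ 2) / 2); first by field.
  by rewrite k12; field.
rewrite !big_ord_recl !big_ord0 /e /cv /= sqrrN expr0n/= mulr0 expR0.
rewrite (_ : n%:R * A b / 2 * 2 ^+ 2 = n%:R * A b + n%:R * A b); last by field.
rewrite expRD /ch expRN.
by field; rewrite gt_eqF ?expR_gt0.
Qed.

(** With one parameter 0 and Z centred under both hypotheses, the mixtures are [f 0 1], depending on
    Y, and [f 1 0], depending on X. Their second moments are the product of ch and their cross
    moment is 1; [lfht_feasible_le] is used with q = 1 and h = (f 0 1 - f 1 0)^2. *)
Lemma lfht_null_lower_bound : G 0 -> eps <= l2norm a ->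
  3 / 2 <= \prod_b ch (n%:R * A b).
Proof.
move=> G0 ea.
pose f k1 k2 w := \prod_b (expR (- (n%:R * A b / 2)) * ch (k1 * X b w + k2 * Y b w)).
have Ef0 : has_expectation P (fun w => f 0 1 w ^+ 2) (\prod_b ch (n%:R * A b)).
  by apply: (@expectation_ch_prod_sq 0 1); ring.
have Ef1 : has_expectation P (fun w => f 1 0 w ^+ 2) (\prod_b ch (n%:R * A b)).
  by apply: (@expectation_ch_prod_sq 1 0); ring.
have Ef01 : has_expectation P (fun w => f 0 1 w * f 1 0 w) 1.
  pose e (i : 'I_2) : R := [:: 1; -1]`_i.
  have := expectation_block_prod Hxi HD n m a bl (fun j => e j.1) (fun j => e j.2)
    (fun=> 0) (fun b (j : 'I_2 * 'I_2) => expR (- (n%:R * A b)) / 4).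
  move=> h; apply: (eq_has_expectation h) => [w|].
    rewrite /f -big_split; apply: eq_bigr => b _ /=.
    have -> : \sum_(j : 'I_2 * 'I_2) expR (- (n%:R * A b)) / 4 *
        expR (e j.1 * X b w + e j.2 * Y b w + 0 * Z b w) =
      \sum_(i < 2) \sum_(j < 2) expR (- (n%:R * A b)) / 4 *
        (expR (e i * X b w) * expR (e j * Y b w)).
      rewrite pair_bigA/=; apply: eq_bigr => -[i j] _; rewrite -expRD.
      by congr (_ * expR _) => /=; ring.
    rewrite !big_ord_recl !big_ord0 /e /= !mul1r !mulN1r !mul0r !(add0r, addr0) /ch.
    have -> : expR (- (n%:R * A b)) = expR (- (n%:R * A b / 2)) ^+ 2.
      by rewrite -expRM_natl; congr expR; field.
    by field.
  rewrite big1// => b _.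
  have -> : \sum_(j : 'I_2 * 'I_2) expR (- (n%:R * A b)) / 4 *
      expR (A b * (n%:R * e j.1 ^+ 2 + n%:R * e j.2 ^+ 2 + m%:R * 0 ^+ 2) / 2) =
    \sum_(j : 'I_2 * 'I_2) 1 / 4.
    apply: eq_bigr => -[i j] _ /=; rewrite mulrAC -expRD; congr (_ / 4).
    apply: etrans (expR0 R); congr expR.
    have e1 k : e k ^+ 2 = 1 by rewrite /e; case: k => -[|[|//]] ? /=; ring.
    by rewrite !e1; field.
  rewrite sumr_const card_prod card_ord -mulr_natl; by field.
pose h w := f 0 1 w ^+ 2 + f 1 0 w ^+ 2 + (-2) * (f 0 1 w * f 1 0 w).
have Eh : has_expectation P h _ :=
  has_expectationD (has_expectationD Ef0 Ef1) (has_expectationZ (-2) Ef01).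
have G0s s : G (signed 0 s).
  rewrite (_ : signed 0 s = 0)//; apply/rowP => i; by rewrite !mxE !mul0r.
have sep k k' s : `|k - k'| = 1 -> eps <= l2norm (signed k s - signed k' s).
  by move=> kk; rewrite l2norm_signedB kk mul1r.
have := @lfht_feasible_le R d Omega P D xi Hxi HD n m G eps {ffun B -> bool}
  (signed 0) (signed 1) (signed 1) (signed 0) _ h _ Hfeas cardS _ _
  (has_expectation_cst P 1) Eh.
move=> H; have : 1 <= \prod_b ch (n%:R * A b) + \prod_b ch (n%:R * A b) + -2 * 1.
  apply: H.
  - by move=> s; split; [ |apply: signed_in; left|apply: sep; rewrite sub0r normrN1].
  - by move=> s; split; [apply: signed_in; left| |apply: sep; rewrite subr0 normr1].
  move=> w; rewrite !mean_likelihood_signed.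
  rewrite (_ : \prod_b _ = f 0 1 w); last first.
    apply: eq_bigr => b _; congr (expR _ * ch _); first by field.
    by ring.
  rewrite (_ : \prod_b (_ * ch (1 * _ + _ + _)) = f 1 0 w); last first.
    apply: eq_bigr => b _; congr (expR _ * ch _); first by field.
    by ring.
  rewrite ler_norml /h; apply/andP.
  have := sqr_ge0 (1 - (f 0 1 w - f 1 0 w)).
  have := sqr_ge0 (1 + (f 0 1 w - f 1 0 w)).
  by split; nra.
lra.
Qed.

End priors.

(** * Orthosymmetric convex sets and numerical lower bounds *)

Section numeric.
Context {R : realType}.

Lemma expR_le_inv (x : R) : x < 1 -> expR x <= (1 - x)^-1.
Proof.
move=> x1; rewrite -[expR x]invrK -expRN lef_pV2 ?posrE ?expR_gt0//; last by lra.
by have := expR_ge1Dx (- x); lra.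
Qed.

(** If |x| >= 1 then |x| <= x^2. Otherwise bound exp x and exp (-x) by (1 - x/2)^-2 and (1 +
    x/2)^-2, whose mean is (1 + u) / (1 - u)^2 with u = x^2 / 4, and compare with (1 + 2u)^2 <= exp
    (x^2). *)
Lemma ch_le_expR_sqr (x : R) : ch x <= expR (x ^+ 2).
Proof.
have [x1|x1] := leP 1 `|x|.
  have sx : `|x| <= x ^+ 2 by rewrite -real_normK ?num_real//; nra.
  have h1 : expR x <= expR (x ^+ 2).
    by rewrite ler_expR (le_trans _ sx)// ler_norm.
  have h2 : expR (- x) <= expR (x ^+ 2).
    by rewrite ler_expR (le_trans _ sx)// -normrN ler_norm.
  by rewrite /ch; lra.
have x2 : x ^+ 2 < 1 by rewrite -real_normK ?num_real// expr_lt1.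
have /andP[xl xr] : - 1 < x < 1 by rewrite -ltr_norml.
pose u := x ^+ 2 / 4.
have u0 : 0 <= u by rewrite divr_ge0// sqr_ge0.
have u1 : u <= 1 / 4 by rewrite /u; lra.
have e1 : expR x <= (1 - x / 2) ^- 2.
  rewrite (_ : x = 2%:R * (x / 2)); last by field.
  rewrite expRM_natl -exprVn; apply: lerXn2r; rewrite ?nnegrE ?expR_ge0 ?invr_ge0//; first by lra.
  rewrite (_ : 2%:R * (x / 2) / 2 = x / 2); last by field.
  by apply: expR_le_inv; lra.
have e2 : expR (- x) <= (1 + x / 2) ^- 2.
  rewrite (_ : - x = 2%:R * (- x / 2)); last by field.
  rewrite expRM_natl -exprVn; apply: lerXn2r; rewrite ?nnegrE ?expR_ge0 ?invr_ge0//; first by lra.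
  rewrite (_ : 1 + x / 2 = 1 - (- x / 2)); last by field.
  by apply: expR_le_inv; lra.
have e3 : (1 + 2 * u) ^+ 2 <= expR (x ^+ 2).
  rewrite (_ : x ^+ 2 = 2%:R * (2 * u)); last by rewrite /u; field.
  by rewrite expRM_natl; apply: lerXn2r; rewrite ?nnegrE ?expR_ge0 ?expR_ge1Dx//; lra.
apply: le_trans e3; rewrite /ch.
have -> : (1 + 2 * u) ^+ 2 = ((1 + 2 * u) ^+ 2 * (1 - u) ^+ 2) / (1 - u) ^+ 2.
  by field; apply/eqP; lra.
have h : 1 + u <= (1 + 2 * u) ^+ 2 * (1 - u) ^+ 2.
  have -> : (1 + 2 * u) ^+ 2 * (1 - u) ^+ 2 = 1 + u + u * (1 - 3 * u - 4 * u ^+ 2 + 4 * u ^+ 3) by ring.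
  rewrite lerDl mulr_ge0//.
  have := exprn_ge0 3 u0; nra.
apply: (@le_trans _ _ ((1 + u) / (1 - u) ^+ 2)).
  rewrite (_ : (1 + u) / (1 - u) ^+ 2 = ((1 - x / 2) ^- 2 + (1 + x / 2) ^- 2) / 2); last first.
    rewrite /u; field; apply/and3P; split; apply/eqP; nra.
  by lra.
by rewrite ler_wpM2r// invr_ge0 sqr_ge0.
Qed.

Lemma prod_1D_le_expR (I : Type) (s : seq I) (c : I -> R) : (forall i, 0 <= c i) ->
  \prod_(i <- s) (1 + c i) <= expR (\sum_(i <- s) c i).
Proof.
move=> c0; rewrite expR_sum; apply: ler_prod => i _.
by rewrite expR_ge1Dx andbT addr_ge0.
Qed.

End numeric.

Section solid.
Context {R : realType}.
Variables (D : nat) (G : set 'rV[R]_D).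
Hypotheses (Gorth : orthosymmetric G) (Gcvx : convex_set_rV G).

(** Coordinates of [x] are replaced by those of [y] one at a time: a point and its reflection in one
    coordinate span a segment in [G] along that coordinate. *)
Lemma orthosymmetric_convex_solid (x y : 'rV[R]_D) : G x ->
  (forall i, `|y ord0 i| <= `|x ord0 i|) -> G y.
Proof.
move=> Gx yx.
pose z k : 'rV[R]_D := \row_i (if (i < k)%N then y ord0 i else x ord0 i).
suff Gz k : (k <= D)%N -> G (z k).
  rewrite (_ : y = z D); first exact: Gz.
  by apply/rowP => i; rewrite !mxE ltn_ord.
elim: k => [_|k IH kD].
  rewrite (_ : z _ = x)//; by apply/rowP => i; rewrite !mxE.
have Gzk := IH (ltnW kD).
pose i0 := Ordinal kD.
have Gf := Gorth Gzk (fun i => i == i0).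
have [x0|x0] := eqVneq (x ord0 i0) 0.
  rewrite (_ : z k.+1 = z k)//; apply/rowP => i; rewrite !mxE ltnS leq_eqVlt.
  case: eqP => [ik|//]; rewrite ik ltnn.
  have -> : i = i0 by apply: val_inj.
  by have := yx i0; rewrite x0 normr0 normr_le0 => /eqP.
(* Mixing x and -x with weights t and 1 - t gives (2t - 1) x, which is y for this t. *)
pose t := (1 + y ord0 i0 / x ord0 i0) / 2.
have yx1 : `|y ord0 i0 / x ord0 i0| <= 1.
  by rewrite normrM normfV ler_pdivrMr ?normr_gt0// mul1r.
have := yx1; rewrite ler_norml => /andP[l1 l2].
have := Gcvx Gzk Gf (t := t).
have -> : t *: z k + (1 - t) *: (\row_i (if i == i0 then - z k ord0 i else z k ord0 i)) = z k.+1.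
  apply/rowP => i; rewrite !mxE ltnS [in RHS]leq_eqVlt.
  have [->|ii0] := eqVneq i i0; first by rewrite /= ltnn eqxx/= /t; field.
  have -> : (nat_of_ord i == k) = false.
    by apply/eqP => ik; move/eqP: ii0; apply; apply: val_inj.
  by case: ifP => _ /=; ring.
by apply; rewrite /t; lra.
Qed.

(** Cap the absolute values of the coordinates at [tau], then multiply by [rho / sqrt S <= 1] to
    reach the prescribed norm. Both operations shrink coordinates, so solidity keeps the point in
    [G]. *)
Lemma exists_truncation (x : 'rV[R]_D) (tau rho : R) : G x -> 0 <= tau -> 0 < rho ->
  rho ^+ 2 <= \sum_(i < D) Num.min (x ord0 i ^+ 2) (tau ^+ 2) ->
  exists a : 'rV[R]_D, [/\ G a, \sum_(i < D) a ord0 i ^+ 2 = rho ^+ 2 &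
    forall i, a ord0 i ^+ 2 <= tau ^+ 2].
Proof.
move=> Gx tau0 rho0; set S := \sum_(i < D) _ => rS.
have S0 : 0 < S by rewrite (lt_le_trans _ rS)// exprn_gt0.
pose c := rho / Num.sqrt S.
have c0 : 0 <= c by rewrite divr_ge0 ?sqrtr_ge0// ltW.
have c2 : c ^+ 2 = rho ^+ 2 / S.
  by rewrite exprMn exprVn sqr_sqrtr// ltW.
have c21 : c ^+ 2 <= 1 by rewrite c2 ler_pdivrMr// mul1r.
have c1 : c <= 1 by rewrite -(@ler_pXn2r _ 2)// ?nnegrE// expr1n.
have min2 i : Num.min `|x ord0 i| tau ^+ 2 = Num.min (x ord0 i ^+ 2) (tau ^+ 2).
  rewrite -[x ord0 i ^+ 2]real_normK ?num_real//.
  case: (leP `|x ord0 i| tau) => h.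
    by rewrite min_l// ler_pXn2r ?nnegrE.
  by rewrite min_r// ler_pXn2r ?nnegrE// ltW.
have min0 i : 0 <= Num.min `|x ord0 i| tau by rewrite le_min normr_ge0.
exists (\row_i (c * Num.min `|x ord0 i| tau)); split.
- apply: (orthosymmetric_convex_solid Gx) => i; rewrite mxE (ger0_norm (mulr_ge0 c0 (min0 i))).
  by rewrite (le_trans (ler_piMl (min0 i) c1))// ge_min lexx.
- transitivity (\sum_(i < D) c ^+ 2 * Num.min (x ord0 i ^+ 2) (tau ^+ 2)).
    by apply: eq_bigr => i _; rewrite mxE exprMn min2.
  by rewrite -mulr_sumr -/S c2 divfK// gt_eqF.
- move=> i; rewrite mxE exprMn min2 (le_trans (ler_piMl _ c21))//.
    by rewrite le_min !sqr_ge0.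
  by rewrite ge_min lexx orbT.
Qed.

Lemma exists_scaling (x : 'rV[R]_D) (rho : R) : G x -> 0 < rho ->
  rho ^+ 2 <= \sum_(i < D) x ord0 i ^+ 2 ->
  exists2 a : 'rV[R]_D, G a & \sum_(i < D) a ord0 i ^+ 2 = rho ^+ 2.
Proof.
move=> Gx rho0; set S := \sum_(i < D) _ => xr.
have S0 : 0 <= S by rewrite sumr_ge0// => i _; rewrite sqr_ge0.
have [|a [Ga aE _]] := exists_truncation Gx (sqrtr_ge0 S) rho0; last by exists a.
rewrite sqr_sqrtr// (le_trans xr)// ler_sum// => i _; rewrite le_min lexx/=.
by rewrite /S (bigD1 i)//= lerDl sumr_ge0// => j _; rewrite sqr_ge0.
Qed.

End solid.

(** * Lower bounds on m, mn and n from a point of the parameter set *)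

Section lower_bounds.
Context {R : realType} {d : measure_display} {Omega : measurableType d}.
Variables (P : probability Omega R) (D : nat) (xi : nat -> 'I_D -> Omega -> R).
Hypotheses (Hxi : std_normal_family P xi) (HD : (0 < D)%N).
Variables (n m : nat) (a : 'rV[R]_D) (G : set 'rV[R]_D) (eps : R).
Hypotheses (Gorth : orthosymmetric G) (Ga : G a) (eps0 : 0 < eps).
Hypothesis Hfeas : lfht_feasible P xi G eps m n.

Let l2normE rho : 0 <= rho -> \sum_(i < D) a ord0 i ^+ 2 = rho ^+ 2 -> l2norm a = rho.
Proof. by move=> r0 h; rewrite /l2norm h sqrtr_sqr ger0_norm. Qed.

(** A single block with a common sign: the bound reads 1/2 <= 2 cf, while cf <= 1 - exp (- m eps^2 /
    4) <= m eps^2 / 4. *)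
Lemma lfht_target_size_ge : \sum_(i < D) a ord0 i ^+ 2 = (eps / 2) ^+ 2 ->
  1 <= m%:R * eps ^+ 2.
Proof.
move=> ha; have la : l2norm a = eps / 2 by apply: (l2normE _ ha); move: eps0; lra.
have ea : eps <= 2 * l2norm a by rewrite la; lra.
have := lfht_opposite_lower_bound Hxi HD (fun=> tt) Gorth Ga Hfeas ea.
have sumU (F : unit -> R) : \sum_b F b = F tt.
  by rewrite (big_pred1 tt)// => -[].
have prodU (F : unit -> R) : \prod_b F b = F tt.
  by rewrite (big_pred1 tt)// => -[].
rewrite sumU prodU /cf /block_sq /tau /sig /block_sq.
rewrite (_ : \sum_(i < D | _) _ = (eps / 2) ^+ 2); last first.
  by rewrite -ha; apply: eq_bigl => i; rewrite eqxx.
rewrite -!expRM_natl.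
set E1 := expR _; set E2 := expR _ => h.
have E10 : 0 <= E1 <= 1.
  rewrite expR_ge0 /= expR_le1 mulrN oppr_le0.
  by apply: mulr_ge0 => //; apply: mulr_ge0 => //; exact: sqr_ge0.
have E20 : 1 - m%:R * eps ^+ 2 / 4 <= E2 <= 1.
  apply/andP; split.
    apply: le_trans (expR_ge1Dx _).
    by rewrite le_eqVlt; apply/orP; left; apply/eqP; field.
  rewrite expR_le1 mulrN oppr_le0; apply: mulr_ge0 => //; apply: divr_ge0 => //.
  by apply: mulr_ge0 => //; exact: sqr_ge0.
by nra.
Qed.

(** One block per coordinate: cf <= 2 n m a_i^4, so the sum S of the cf is at most n m rho2 eps^2 /
    2. If S < 1/5, then exp S - 1 + S < 1/4 + 1/5 < 1/2, contradicting the opposite-sign bound. *)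
Lemma lfht_product_ge rho2 : \sum_(i < D) a ord0 i ^+ 2 = (eps / 2) ^+ 2 ->
  (forall i, a ord0 i ^+ 2 <= rho2) ->
  2 / 5 <= n%:R * m%:R * (rho2 * eps ^+ 2).
Proof.
move=> ha ar; have la : l2norm a = eps / 2 by apply: (l2normE _ ha); move: eps0; lra.
have ea : eps <= 2 * l2norm a by rewrite la; lra.
have := lfht_opposite_lower_bound Hxi HD id Gorth Ga Hfeas ea.
have AE (i : 'I_D) : block_sq a id i = a ord0 i ^+ 2 by rewrite /block_sq (big_pred1 i).
have na0 (i : 'I_D) : 0 <= n%:R * a ord0 i ^+ 2.
  by apply: mulr_ge0 => //; exact: sqr_ge0.
have ma0 (i : 'I_D) : 0 <= m%:R * a ord0 i ^+ 2.
  by apply: mulr_ge0 => //; exact: sqr_ge0.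
have c0 (i : 'I_D) : 0 <= cf n m a id i.
  rewrite /cf /tau /sig AE -!expRM_natl.
  have := na0 i; have := ma0 i => h1 h2.
  by apply: mulr_ge0; rewrite subr_ge0 expR_le1; lra.
have cle (i : 'I_D) : cf n m a id i <= 2 * n%:R * m%:R * (rho2 * a ord0 i ^+ 2).
  apply: (@le_trans _ _ ((2 * n%:R * a ord0 i ^+ 2) * (m%:R * a ord0 i ^+ 2))).
    rewrite /cf /tau /sig AE -!expRM_natl.
    have := na0 i; have := ma0 i => h1 h2.
    apply: ler_pM.
    - by rewrite subr_ge0 expR_le1; lra.
    - by rewrite subr_ge0 expR_le1; lra.
      rewrite lerBlDl -lerBlDr; apply: le_trans (expR_ge1Dx _).
      by rewrite le_eqVlt; apply/orP; left; apply/eqP; field.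
    rewrite lerBlDl -lerBlDr; apply: le_trans (expR_ge1Dx _).
    by rewrite le_eqVlt; apply/orP; left; apply/eqP; field.
  have -> : 2 * n%:R * a ord0 i ^+ 2 * (m%:R * a ord0 i ^+ 2) =
    2 * n%:R * m%:R * (a ord0 i ^+ 2 * a ord0 i ^+ 2) by ring.
  by rewrite ler_wpM2l ?mulr_ge0// ler_wpM2r ?sqr_ge0.
have := prod_1D_le_expR (index_enum 'I_D) c0.
set S := \sum_i _; set Pr := \prod_i _ => PS h.
have S0 : 0 <= S by apply: sumr_ge0.
have Sle : S <= n%:R * m%:R * (rho2 * eps ^+ 2) / 2.
  apply: (@le_trans _ _ (2 * n%:R * m%:R * (rho2 * (eps / 2) ^+ 2))).
    by rewrite -ha !mulr_sumr; apply: ler_sum => i _; exact: cle.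
  by rewrite le_eqVlt; apply/orP; left; apply/eqP; field.
have [S5|S5] := leP (1 / 5) S; first by lra.
have := expR_ge1Dx (- S); have := expRxMexpNx_1 S; have := expR_gt0 S.
by nra.
Qed.

(** Here 3/2 <= exp S, with S the sum of the (n a_i^2)^2. Since exp S <= 1 / (1 - S), S < 1/3 is
    impossible. *)
Lemma lfht_simulation_size_ge rho2 : G 0 -> \sum_(i < D) a ord0 i ^+ 2 = eps ^+ 2 ->
  (forall i, a ord0 i ^+ 2 <= rho2) ->
  1 / 3 <= n%:R ^+ 2 * (rho2 * eps ^+ 2).
Proof.
move=> G0 ha ar; have la : l2norm a = eps by apply: (l2normE _ ha); move: eps0; lra.
have ea : eps <= l2norm a by rewrite la.
have := lfht_null_lower_bound Hxi HD id Gorth Ga Hfeas G0 ea.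
have AE (i : 'I_D) : block_sq a id i = a ord0 i ^+ 2 by rewrite /block_sq (big_pred1 i).
have : \prod_i ch (n%:R * block_sq a id i) <=
    expR (\sum_(i < D) (n%:R * block_sq a id i) ^+ 2).
  rewrite expR_sum; apply: ler_prod => i _.
  by rewrite ch_le_expR_sqr (ltW (ch_gt0 _)).
set S := \sum_i _; set Pr := \prod_i _ => PS h.
have Sle : S <= n%:R ^+ 2 * (rho2 * eps ^+ 2).
  rewrite -ha !mulr_sumr; apply: ler_sum => i _; rewrite AE exprMn expr2.
  by rewrite ler_wpM2l// ?mulr_ge0// expr2 ler_wpM2r ?sqr_ge0.
have [S3|S3] := leP (1 / 3) S; first by lra.
have := expR_ge1Dx (- S); have := expRxMexpNx_1 S; have := expR_gt0 S.
by nra.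
Qed.

End lower_bounds.

(** * Soft thresholding *)

Section soft_threshold.
Context {R : realType}.
Implicit Types l x mu g b : R.

(** For [0 <= l] at most one summand is non-zero; in this form measurability is immediate. *)
Definition soft l x : R := Num.max (x - l) 0 + Num.min (x + l) 0.

Lemma measurable_soft l : measurable_fun [set: R] (soft l).
Proof.
apply: measurable_funD.
  by apply: measurable_maxr => //; apply: measurable_funB.
by apply: measurable_minr => //; apply: measurable_funD.
Qed.

Lemma soft_err l mu g : 0 <= l ->
  `|soft l (mu + g) - mu| <= Num.min `|mu| (2 * l) + Num.max (`|g| - l) 0.
Proof.
move=> l0; rewrite /soft.
have [h1|h1] := leP (mu + g - l) 0; have [h2|h2] := leP (mu + g + l) 0;
have [h3|h3] := leP `|mu| (2 * l); have [h4|h4] := leP (`|g| - l) 0;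
  move: h3 h4; have [m0|m0] := leP 0 mu; have [g0|g0] := leP 0 g;
  rewrite ?(ger0_norm m0) ?(ltr0_norm m0) ?(ger0_norm g0) ?(ltr0_norm g0) => h3 h4;
  by rewrite ler_norml; apply/andP; split; lra.
Qed.

(** From x^2 <= (2 / b^2) exp (b x) for x >= 0, with x = |g| - l. This replaces a Gaussian tail
    integral by moment generating functions. *)
Lemma soft_excess_le l g b : 0 < b ->
  Num.max (`|g| - l) 0 ^+ 2 <= 2 / b ^+ 2 * expR (- (b * l)) * (expR (b * g) + expR (- b * g)).
Proof.
move=> b0.
have K0 : 0 <= 2 / b ^+ 2 * expR (- (b * l)) * (expR (b * g) + expR (- b * g)).
  by rewrite mulr_ge0 ?addr_ge0 ?expR_ge0// mulr_ge0 ?expR_ge0// divr_ge0// sqr_ge0.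
have [h|h] := leP (`|g| - l) 0; first by rewrite expr0n.
have e1 : expR (b * `|g|) <= expR (b * g) + expR (- b * g).
  have := expR_ge0 (b * g); have := expR_ge0 (- b * g).
  have [g0|g0] := leP 0 g; first by rewrite (ger0_norm g0); lra.
  by rewrite (ltr0_norm g0) mulrN -mulNr; lra.
have := @expR_ge1Dxn R (b * (`|g| - l)) 1 (mulr_ge0 (ltW b0) (ltW h)).
rewrite (_ : 2`!%:R = 2)//.
rewrite mulrBr expRD => e2.
rewrite -mulrA mulrAC ler_pdivlMr ?exprn_gt0//.
have : expR (b * `|g|) * expR (- (b * l)) <= expR (- (b * l)) * (expR (b * g) + expR (- b * g)).
  by rewrite mulrC ler_wpM2l ?expR_ge0.
by nra.
Qed.

Lemma soft_sqerr_le l mu g b : 0 <= l -> 0 < b ->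
  (soft l (mu + g) - mu) ^+ 2 <= 3 / 2 * Num.min (mu ^+ 2) ((2 * l) ^+ 2) +
    3 * (2 / b ^+ 2 * expR (- (b * l))) * (expR (b * g) + expR (- b * g)).
Proof.
move=> l0 b0.
have := soft_err mu g l0; have := soft_excess_le l g b0.
set v := Num.max _ _; set s := Num.min _ _ => hv hs.
have v0 : 0 <= v by rewrite le_max lexx orbT.
have s0 : 0 <= s by rewrite le_min normr_ge0 mulr_ge0.
have -> : Num.min (mu ^+ 2) ((2 * l) ^+ 2) = s ^+ 2.
  rewrite -[mu ^+ 2]real_normK ?num_real// /s.
  case: (leP `|mu| (2 * l)) => h.
    by rewrite min_l// ler_pXn2r ?nnegrE ?mulr_ge0.
  by rewrite min_r// ler_pXn2r ?nnegrE ?mulr_ge0// ltW.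
(* 3/2 s^2 + 3 v^2 exceeds (s + v)^2 by (s - 2v)^2 / 2. *)
apply: (@le_trans _ _ (3 / 2 * s ^+ 2 + 3 * v ^+ 2)); last by lra.
apply: (@le_trans _ _ ((s + v) ^+ 2)).
  by rewrite -real_normK ?num_real// ler_pXn2r ?nnegrE ?addr_ge0.
by have := sqr_ge0 (s - 2 * v); nra.
Qed.

End soft_threshold.

(** * Risk of the soft-thresholding estimator *)

Section estimation.
Context {R : realType} {d : measure_display} {Omega : measurableType d}.
Variables (P : probability Omega R) (D : nat) (xi : nat -> 'I_D -> Omega -> R).
Hypotheses (Hxi : std_normal_family P xi) (HD : (0 < D)%N).

Lemma mgf_col_sum k (i : 'I_D) c :
  has_expectation P (fun w => expR (c * col_sum xi 0 k i w)) (expR (k%:R * c ^+ 2 / 2)).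
Proof.
(* The column sum is isolated by taking [m = 0] and a mean for X supported on coordinate [i]. *)
pose th : 'rV[R]_D := \row_j (if j == i then c else 0).
apply: (eq_has_expectation (mgf_lfht Hxi HD k 0 th 0 0)).
  move=> w; congr expR; rewrite /lfht_exponent (bigD1 i)//= !mxE eqxx big1 => [|j ji].
    by ring.
  by rewrite !mxE (negbTE ji); ring.
congr (expR (_ / 2)); rewrite /lfht_energy (bigD1 i)//= !mxE eqxx big1 => [|j ji].
  by ring.
by rewrite !mxE (negbTE ji); ring.
Qed.

Lemma estimable0 (G : set 'rV[R]_D) (r : R) :
  (forall th, G th -> \sum_(i < D) th ord0 i ^+ 2 <= r ^+ 2) -> estimable P xi G r 0.
Proof.
move=> Gr; exists (fun=> [tuple 0 | i < D]); split; first exact: measurable_cst.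
move=> th Gth; rewrite integral_cst//= probability_setT mule1 lee_fin.
apply: le_trans (Gr _ Gth); rewrite le_eqVlt; apply/orP; left; apply/eqP.
by apply: eq_bigr => i _; rewrite tnth_mktuple sub0r sqrrN.
Qed.

Lemma ln4D_ge1 : 1 <= ln (4 * D%:R) :> R.
Proof.
have D1 : 1 <= D%:R :> R by rewrite ler1n.
rewrite -[leLHS](@expRK R) ler_ln ?posrE ?expR_gt0//; last by lra.
have -> : expR 1 = expR (1 / 2) ^+ 2 :> R.
  by rewrite -expRM_natl; congr expR; field.
have := expR_ge1Dx (- (1 / 2) : R); have := expRxMexpNx_1 (1 / 2 : R).
by have := expR_gt0 (1 / 2 : R); nra.
Qed.

Lemma soft_threshold_estimable (G : set 'rV[R]_D) (eps : R) (k : nat) :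
  3 <= k%:R * eps ^+ 2 ->
  (forall th, G th -> \sum_(i < D) Num.min (th ord0 i ^+ 2)
     (8 * ln (4 * D%:R) / k%:R) <= eps ^+ 2) ->
  estimable P xi G (Num.sqrt 2 * eps) k.
Proof.
move=> k3 Hmin; set L := ln (4 * D%:R) in Hmin.
have L1 : 1 <= L := ln4D_ge1.
have k0 : 0 < k%:R :> R.
  by rewrite lt_neqAle ler0n andbT eq_sym; apply/eqP => k0; rewrite k0 mul0r in k3; lra.
(* With this threshold the cap [(2 * l) ^+ 2] of [soft_sqerr_le] is 8 L / k. *)
pose l := Num.sqrt (2 * L / k%:R).
have l2 : l ^+ 2 = 2 * L / k%:R by rewrite sqr_sqrtr// divr_ge0//; lra.
have l0 : 0 < l by rewrite sqrtr_gt0 divr_gt0//; lra.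
pose est (t : k.-tuple (D.-tuple R)) : D.-tuple R :=
  [tuple soft l ((\sum_(j < k) tnth (tnth t j) i) / k%:R) | i < D].
have mest : measurable_fun setT est.
  apply/measurable_fun_tnthP => i.
  rewrite (_ : _ \o _ = soft l \o
      (fun t => (\sum_(j < k) tnth (tnth t j) i) / k%:R)); last first.
    by apply/funext => t /=; rewrite tnth_mktuple.
  apply: measurableT_comp; first exact: measurable_soft.
  apply: measurable_funM => //; apply: measurable_sum => j.
  exact: (measurableT_comp (measurable_tnth i) (measurable_tnth j)).
exists est; split=> // th Gth.
(* Then b times the averaged noise is l times the column sum, with exponential moment exp L, while
   exp (- b l) = exp (- 2 L). The remaining exp (- L) = 1 / (4 D) absorbs the sum over D
   coordinates, leaving 3 / (2 L k) <= eps^2 / 2. *)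
pose b := k%:R * l.
have b0 : 0 < b by rewrite mulr_gt0.
have b2 : b ^+ 2 = 2 * L * k%:R by rewrite exprMn l2; field; rewrite gt_eqF.
pose C := 3 * (2 / b ^+ 2 * expR (- (b * l))).
have [mxi _] := Hxi.
pose err w := \sum_(i < D) (soft l (th ord0 i + col_sum xi 0 k i w / k%:R) - th ord0 i) ^+ 2.
have errE w : sqerr (est (sample xi th 0 k w)) th = err w.
  apply: eq_bigr => i _; congr ((_ - _) ^+ 2); rewrite tnth_mktuple; congr soft.
  under eq_bigr do rewrite !tnth_mktuple.
  rewrite big_split/= sumr_const card_ord -[th ord0 i *+ k]mulr_natl /col_sum.
  by field; rewrite gt_eqF.
under eq_integral do rewrite errE.
pose F w := \sum_(i < D) (3 / 2 * Num.min (th ord0 i ^+ 2) ((2 * l) ^+ 2) +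
   C * (expR (l * col_sum xi 0 k i w) + expR (- l * col_sum xi 0 k i w))).
have EF : has_expectation P F (\sum_(i < D) (3 / 2 * Num.min (th ord0 i ^+ 2) ((2 * l) ^+ 2) +
   C * (expR (k%:R * l ^+ 2 / 2) + expR (k%:R * (- l) ^+ 2 / 2)))).
  apply: has_expectation_sum => i; apply: has_expectationD.
    exact: has_expectation_cst.
  by apply: has_expectationZ; apply: has_expectationD; exact: mgf_col_sum.
have [iF EFv] := EF.
have merr : measurable_fun setT err.
  apply: measurable_sum => i; apply: measurable_funX; apply: measurable_funB => //.
  apply: (measurableT_comp (@measurable_soft R l)); apply: measurable_funD => //.
  by apply: measurable_funM => //; exact: (measurable_col_sum Hxi).
apply: (@le_trans _ _ (\int[P]_w (F w)%:E)%E).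
  apply: ge0_le_integral => //.
  - by move=> w _; rewrite lee_fin sumr_ge0// => i _; rewrite sqr_ge0.
  - exact/measurable_EFinP.
  - exact: (measurable_int _ iF).
  - move=> w _; rewrite lee_fin; apply: ler_sum => i _.
    have := soft_sqerr_le (th ord0 i) (col_sum xi 0 k i w / k%:R) (ltW l0) b0.
    rewrite -/C.
    rewrite (_ : b * _ = l * col_sum xi 0 k i w); last by rewrite /b; field; rewrite gt_eqF.
    by rewrite (_ : - b * _ = - l * col_sum xi 0 k i w)// /b; field; rewrite gt_eqF.
rewrite EFv lee_fin big_split/= -mulr_sumr.
have -> : \sum_(i < D) Num.min (th ord0 i ^+ 2) ((2 * l) ^+ 2) =
    \sum_(i < D) Num.min (th ord0 i ^+ 2) (8 * L / k%:R).
  by apply: eq_bigr => i _; congr Num.min; rewrite exprMn l2; field; rewrite gt_eqF.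
have h1 := Hmin th Gth.
rewrite sumr_const card_ord -[_ *+ D]mulr_natl sqrrN.
have D0 : 0 < D%:R :> R by rewrite ltr0n.
have eL : expR L = 4 * D%:R by rewrite lnK// posrE mulr_gt0.
have -> : k%:R * l ^+ 2 / 2 = L by rewrite l2; field; rewrite gt_eqF.
have bl : b * l = L + L by rewrite /b -mulrA -expr2 l2; field; rewrite gt_eqF.
have -> : D%:R * (C * (expR L + expR L)) = 3 / (2 * L * k%:R).
  rewrite /C b2 bl opprD expRD expRN eL; field.
  by rewrite !gt_eqF//; lra.
have h2 : 3 / (2 * L * k%:R) <= 3 / (2 * k%:R).
  by rewrite ler_pM2l// lef_pV2 ?posrE ?mulr_gt0//; nra.
have h3 : 3 / (2 * k%:R) <= eps ^+ 2 / 2.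
  by rewrite ler_pdivrMr ?mulr_gt0//; nra.
rewrite exprMn sqr_sqrtr//; lra.
Qed.

End estimation.

(** * From minimality of the estimation sample size to the three inequalities *)

Theorem mainTheorem6 (R : realType) (d : measure_display) (Omega : measurableType d)
    (P : probability Omega R) (D : nat) (xi : nat -> 'I_D -> Omega -> R)
    (Hxi : std_normal_family P xi) (HD : (0 < D)%N)
    (G : set 'rV[R]_D) (Gorth : orthosymmetric G) (Gcpt : compact G)
    (Gcvx : convex_set_rV G) (eps : R) (Heps : 0 < eps)
    (Hnontriv : exists theta1 theta2, G theta1 /\ G theta2 /\
                  eps <= l2norm (theta1 - theta2))
    (m n : nat) (Hm : (0 < m)%N) (Hn : (0 < n)%N)
    (Hfeas : lfht_feasible P xi G eps m n)
    (N : nat) (HN : is_n_est P xi G (Num.sqrt 2 * eps) N) :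
  1 / eps ^+ 2 <= m%:R /\
  Num.sqrt N%:R / (8 * eps * Num.sqrt (ln (4 * D%:R))) <= n%:R /\
  (N%:R - 1) / (3072 * eps ^+ 2 * ln (4 * D%:R)) <= (m * n)%:R.
Proof.
have [t1 [t2 [Gt1 [Gt2 t12]]]] := Hnontriv.
set L := ln (4 * D%:R); have L1 : 1 <= L := @ln4D_ge1 R D HD.
have e2 : 0 < eps ^+ 2 by rewrite exprn_gt0.
have eh : 0 < eps / 2 by rewrite divr_gt0.
have n1 : 1 <= n%:R :> R by rewrite ler1n.
have G0 : G 0.
  by apply: (orthosymmetric_convex_solid Gorth Gcvx Gt1) => i; rewrite mxE normr0.
have m1 : 1 <= m%:R * eps ^+ 2.
  (* Half the difference is the midpoint of [t1] and the reflected point [- t2], so it lies in [G],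
     with norm at least eps / 2. *)
  pose x : 'rV[R]_D := \row_i ((t1 - t2) ord0 i / 2).
  have Gx : G x.
    have Gt2' := Gorth _ Gt2 (fun=> true).
    have := Gcvx _ _ Gt1 Gt2' (1 / 2); rewrite (_ : _ + _ = x); last first.
      by apply/rowP => i; rewrite !mxE; field.
    by apply; lra.
  have [|a Ga aE] := exists_scaling Gorth Gcvx Gx eh.
    have -> : \sum_(i < D) x ord0 i ^+ 2 = l2norm (t1 - t2) ^+ 2 / 4.
      rewrite sqr_sqrtr ?mulr_suml; last by rewrite sumr_ge0// => i _; rewrite sqr_ge0.
      by apply: eq_bigr => i _; rewrite !mxE; field.
    by nra.
  exact: (lfht_target_size_ge Hxi HD Gorth Ga Heps Hfeas).
have [HNe HNmin] := HN.
have nsuff : N%:R <= 64 * eps ^+ 2 * L * n%:R ^+ 2 ->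
    Num.sqrt N%:R / (8 * eps * Num.sqrt L) <= n%:R.
  move=> h; rewrite ler_pdivrMr; last by rewrite !mulr_gt0// sqrtr_gt0; lra.
  rewrite -(@ler_pXn2r _ 2)// ?nnegrE ?sqrtr_ge0//; last first.
    by rewrite !mulr_ge0 ?sqrtr_ge0// ltW.
  rewrite sqr_sqrtr// !exprMn sqr_sqrtr; last by lra.
  by lra.
(* The constant is abstracted to keep a large numeral out of the arithmetic; the factor 20 is what
   2/5 k <= 8 L n m eps^2 yields. *)
have [c <- c20] : exists2 c : R, c = 3072 & 20 <= c by exists 3072; rewrite ?ler_nat.
have mnsuff : N%:R - 1 <= c * eps ^+ 2 * L * (n%:R * m%:R) ->
    (N%:R - 1) / (c * eps ^+ 2 * L) <= (m * n)%:R.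
  move=> h; rewrite ler_pdivrMr; last by rewrite !mulr_gt0//; lra.
  by rewrite natrM; lra.
split; first by rewrite ler_pdivrMr.
(* For N = k + 1, minimality says that k samples do not suffice; this is the source of [N - 1] in
   the third bound. For N = 0 both left sides are at most 0. *)
case: N => [|k] in HN HNe HNmin nsuff mnsuff *.
  split; first by rewrite sqrtr0 mul0r.
  apply: mnsuff; rewrite sub0r; apply: (@le_trans _ _ 0); first by rewrite oppr_le0.
  by rewrite !mulr_ge0//; lra.
have kN : k.+1%:R = k%:R + 1 :> R by rewrite -natr1.
rewrite kN in nsuff mnsuff *.
(* If k eps^2 >= 3, failure of soft thresholding provides the point [x]; otherwise failure of the
   zero estimator suffices. *)
have [ek|ek] := leP 3 (k%:R * eps ^+ 2).
  have k0 : 0 < k%:R :> R.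
    by rewrite lt_neqAle ler0n andbT eq_sym; apply/eqP => k0; rewrite k0 mul0r in ek; lra.
  have k1 : 1 <= k%:R :> R by rewrite ler1n lt0n -(eqr_nat R) gt_eqF.
  pose tau2 := 8 * L / k%:R.
  have tau20 : 0 <= tau2 by rewrite divr_ge0// mulr_ge0//; lra.
  have [x Gx xmin] : exists2 x, G x & eps ^+ 2 <= \sum_(i < D) Num.min (x ord0 i ^+ 2) tau2.
    apply: contrapT => hx.
    have : estimable P xi G (Num.sqrt 2 * eps) k.
      apply: soft_threshold_estimable => // th Gth; apply: contrapT => /negP.
      by rewrite -ltNge => /ltW h; apply: hx; exists th.
    by move=> /HNmin; rewrite ltnn.
  rewrite -(sqr_sqrtr tau20) in xmin.
  have tauk : tau2 * k%:R = 8 * L by rewrite divfK// gt_eqF.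
  split.
    (* Norm eps here, since one parameter is 0; norm eps / 2 for the opposite pair below. This gives
       k <= 24 n^2 eps^2 L, and k + 1 <= 2k absorbs the off-by-one. *)
    have [a [Ga aE atau]] := exists_truncation Gorth Gcvx Gx (sqrtr_ge0 _) Heps xmin.
    have := lfht_simulation_size_ge Hxi HD Gorth Ga Heps Hfeas G0 aE atau.
    rewrite sqr_sqrtr// => h; apply: nsuff.
    have : 1 / 3 * k%:R <= n%:R ^+ 2 * (tau2 * eps ^+ 2) * k%:R by rewrite ler_wpM2r.
    rewrite (_ : n%:R ^+ 2 * (tau2 * eps ^+ 2) * k%:R = n%:R ^+ 2 * eps ^+ 2 * (tau2 * k%:R)); last by ring.
    by rewrite tauk; lra.
  have xmin4 : (eps / 2) ^+ 2 <= \sum_(i < D) Num.min (x ord0 i ^+ 2) (Num.sqrt tau2 ^+ 2).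
    by apply: le_trans xmin; nra.
  have [a [Ga aE atau]] := exists_truncation Gorth Gcvx Gx (sqrtr_ge0 _) eh xmin4.
  have := lfht_product_ge Hxi HD Gorth Ga Heps Hfeas aE atau.
  rewrite sqr_sqrtr// => h; apply: mnsuff.
  have : 2 / 5 * k%:R <= n%:R * m%:R * (tau2 * eps ^+ 2) * k%:R by rewrite ler_wpM2r.
  rewrite (_ : n%:R * m%:R * (tau2 * eps ^+ 2) * k%:R = n%:R * m%:R * eps ^+ 2 * (tau2 * k%:R)); last by ring.
  have z0 : 0 <= n%:R * m%:R * eps ^+ 2 * L by rewrite !mulr_ge0//; lra.
  have : 20 * (n%:R * m%:R * eps ^+ 2 * L) <= c * (n%:R * m%:R * eps ^+ 2 * L).
    exact: ler_wpM2r.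
  by rewrite tauk; lra.
have [x Gx xbig] : exists2 x, G x & eps ^+ 2 <= \sum_(i < D) x ord0 i ^+ 2.
  apply: contrapT => hx.
  have : estimable P xi G (Num.sqrt 2 * eps) 0.
    apply: estimable0 => th Gth; apply: contrapT => /negP.
    rewrite -ltNge exprMn sqr_sqrtr// => h; apply: hx; exists th => //; lra.
  by move=> /HNmin.
have [a Ga aE] := exists_scaling Gorth Gcvx Gx Heps xbig.
(* The trivial cap by the whole squared norm now suffices: it gives (n E)^2 >= 1/3 with E =
   eps^2. *)
have atau i : a ord0 i ^+ 2 <= eps ^+ 2.
  by rewrite -aE (bigD1 i)//= lerDl sumr_ge0// => j _; rewrite sqr_ge0.
have := lfht_simulation_size_ge Hxi HD Gorth Ga Heps Hfeas G0 aE atau.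
set E := eps ^+ 2 in ek e2 m1 nsuff mnsuff *.
rewrite (_ : n%:R ^+ 2 * (E * E) = (n%:R * E) ^+ 2); last by ring.
move=> nE; have nE0 : 0 < n%:R * E by rewrite mulr_gt0//; lra.
split.
  apply: nsuff.
  (* If E <= 1 then (k + 1) E < 4, to be compared with 64 L (n E)^2 >= 64/3; if E > 1 then k < 3 and
     n >= 1 is enough. *)
  have [E1|E1] := leP E 1.
    rewrite -(ler_pM2r e2) (_ : 64 * E * L * n%:R ^+ 2 * E = 64 * L * (n%:R * E) ^+ 2); last by ring.
    by nra.
  have : k%:R < 3 :> R by nra.
  have : 1 <= n%:R ^+ 2 :> R by nra.
  by nra.
apply: mnsuff; rewrite -(ler_pM2r e2).
have -> : c * E * L * (n%:R * m%:R) * E = c * L * ((n%:R * E) * (m%:R * E)) by ring.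
(* After multiplication by E the left side is k E < 3, while the right side is at least 20 * (1/2),
   by n E >= 1/2 and m E >= 1. *)
have nE2 : 1 / 2 <= n%:R * E by nra.
have y2 : 1 / 2 <= n%:R * E * (m%:R * E) by nra.
have cL : 20 <= c * L by nra.
by nra.
Qed.
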